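(* Let $d\in\mathbb{N}$ and let $S_N=\sum_{n=1}^N X_n$ be a random walk on $\mathbb{Z}^d$ with i.i.d. steps satisfying the non-degeneracy and aperiodicity assumptions of the context. Suppose that $\mathbb{E}(X_1)=0$ and $\mathbb{E}(|X_1|^k)<\infty$ for all $k\in\mathbb{N}$. Let $$\rho_d(\beta)=\begin{cases}\frac12&\text{if }\beta\le\frac{d-1}{d}\\ \frac d2(\beta-1)+1&\text{if }\beta>\frac{d-1}{d},\end{cases}\qquad \gamma(d,\beta,\varepsilon)=\begin{cases}\frac2\beta&\text{if }d=1\\ \frac1\varepsilon&\text{if }d\ge2.\end{cases}$$ Then for every $\beta\in[0,1)$, every $\varepsilon>0$ and every $F\in\mathbf{G}^{\beta}_{\gamma(d,\beta,\varepsilon)}$ with $\bar F=0$, writing $T_N=\sum_{n=1}^NF(S_n)$, $$\frac{T_N}{N^{\rho_d(\beta)+\varepsilon}}\to0\quad\text{almost surely as }N\to\infty.$$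
   Context: $X_1,X_2,\dots$ are i.i.d. $\mathbb{Z}^d$-valued random variables, $S_0=0$, $S_N=\sum_{n=1}^N X_n$. Standing assumptions: (non-degeneracy) the smallest group supporting the range of $X_1$ is $\mathbb{Z}^d$; (aperiodicity) $\gcd\{n>0:\mathbb{P}(S_n=0)>0\}=1$. For a non-empty finite $V\subset\mathbb{Z}^d$ and a bounded $F:\mathbb{Z}^d\to\mathbb{R}$, $\bar F_V=\frac1{|V|}\sum_{v\in V}F(v)$. For real $a_j<b_j$, $V(a_1,b_1,\dots,a_d,b_d)=\{x\in\mathbb{Z}^d:x_j\in[a_j,b_j],\ j=1,\dots,d\}$. For $\gamma>0$, $\mathbf{G}^\beta_\gamma$ is the set of bounded $F:\mathbb{Z}^d\to\mathbb{R}$ for which there is a number $\bar F$ such that for all $a_1<b_1,\dots,a_d<b_d$ there is a constant $C$ such that for all $L>0$ and all $z\in\mathbb{Z}^d$ with $|z|<L^\gamma$ (and $V(a_1L,b_1L,\dots,a_dL,b_dL)\ne\emptyset$), $$\left|\bar F_{z+V(a_1L,b_1L,\dots,a_dL,b_dL)}-\bar F\right|<C L^{d(\beta-1)}.$$ Also $\mathbf{G}^\beta_\infty=\bigcap_{\gamma>0}\mathbf{G}^\beta_\gamma$. When $d=1$ and $\beta=0$, $2/\beta$ is interpreted as $\infty$. *)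

(* Defs.v *)
From HB Require Import structures.
From mathcomp Require Import all_boot all_order all_algebra finmap.
From mathcomp Require Import all_classical all_reals all_analysis.

Set Implicit Arguments.
Unset Strict Implicit.
Unset Printing Implicit Defensive.

Import Order.TTheory GRing.Theory Num.Theory.
Import numFieldNormedType.Exports.

Local Open Scope classical_set_scope.
Local Open Scope ring_scope.

(* Z^d is 'rV[int]_d; its Euclidean norm. *)
Definition enorm (R : realType) (d : nat) (x : 'rV[int]_d) : R :=
  Num.sqrt (\sum_(j < d) ((x ord0 j)%:~R : R) ^+ 2).

Definition is_subgroup (G : zmodType) (H : set G) : Prop :=
  H 0 /\ forall x y, H x -> H y -> H (x - y).

(* gcd of a possibly infinite set of naturals, as greatest lower bound for
   divisibility. *)
Definition is_gcd (A : set nat) (g : nat) : Prop :=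
  (forall n, A n -> g %| n)%N /\
  forall g', (forall n, A n -> (g' %| n)%N) -> (g' %| g)%N.

Section RandomWalk.
Context {disp : measure_display} {T : measurableType disp} {R : realType}.
Context {d : nat}.

(* Random variables with values in the discrete space Z^d. *)
Definition discrete_rv (Y : T -> 'rV[int]_d) : Prop :=
  forall A : set 'rV[int]_d, measurable (Y @^-1` A).

Definition mutually_independent (P : probability T R)
    (X : nat -> T -> 'rV[int]_d) : Prop :=
  forall (I : {fset nat}) (A : nat -> set 'rV[int]_d),
    P (\bigcap_(i in [set` I]) (X i @^-1` A i)) =
    (\prod_(i <- I) P (X i @^-1` A i))%E.

Definition identically_distributed (P : probability T R)
    (X : nat -> T -> 'rV[int]_d) : Prop :=
  forall (n : nat) (A : set 'rV[int]_d), P (X n @^-1` A) = P (X 0%N @^-1` A).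

Definition iid_steps (P : probability T R) (X : nat -> T -> 'rV[int]_d) : Prop :=
  [/\ forall n, discrete_rv (X n),
      mutually_independent P X & identically_distributed P X].

(* Steps are indexed from 0: X n is the (n+1)-st step, so that
   walk X N is the sum of the first N steps. *)
Definition walk (X : nat -> T -> 'rV[int]_d) (N : nat) (w : T) : 'rV[int]_d :=
  \sum_(n < N) X n w.

Definition law_support (P : probability T R) (Y : T -> 'rV[int]_d) :
    set 'rV[int]_d :=
  [set v | (0 < P (Y @^-1` [set v]))%E].

Definition nondegenerate_step (P : probability T R) (X : nat -> T -> 'rV[int]_d) :
    Prop :=
  smallest (@is_subgroup 'rV[int]_d) (law_support P (X 0%N)) = [set: 'rV[int]_d].

Definition aperiodic_walk (P : probability T R) (X : nat -> T -> 'rV[int]_d) :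
    Prop :=
  is_gcd [set n | (0 < n)%N /\ (0 < P (walk X n @^-1` [set 0%R]))%E] 1%N.

Definition ergodic_sum (F : 'rV[int]_d -> R) (X : nat -> T -> 'rV[int]_d)
    (N : nat) (w : T) : R :=
  \sum_(1 <= n < N.+1) F (walk X n w).

End RandomWalk.

Section GlobalObservables.
Context {R : realType} {d : nat}.

Definition lattice_box (a b : 'I_d -> R) : set 'rV[int]_d :=
  [set x | forall j, a j <= (x ord0 j)%:~R <= b j].

Definition translate (z : 'rV[int]_d) (V : set 'rV[int]_d) : set 'rV[int]_d :=
  [set z + v | v in V].

(* Used only for nonempty finite V. *)
Definition average (F : 'rV[int]_d -> R) (V : set 'rV[int]_d) : R :=
  (\sum_(v <- fset_set V) F v) / (#|` fset_set V|)%:R.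

Definition average_bound (beta gamma : R) (F : 'rV[int]_d -> R) (m : R) :
    Prop :=
  forall a b : 'I_d -> R, (forall j, a j < b j) ->
  exists C : R, forall (L : R) (z : 'rV[int]_d), 0 < L ->
    enorm R z < L `^ gamma ->
    lattice_box (fun j => a j * L) (fun j => b j * L) !=set0 ->
    `|average F (translate z (lattice_box (fun j => a j * L) (fun j => b j * L))) - m|
      < C * L `^ (d%:R * (beta - 1)).

(* The class G^beta_gamma for real gamma. *)
Definition G_fin (beta gamma : R) : set ('rV[int]_d -> R) :=
  [set F | [bounded F v | v in [set: 'rV[int]_d]] /\
           exists m, average_bound beta gamma F m].

(* The class G^beta_gamma for 0 < gamma <= +oo; -oo is a junk value. *)
Definition G_class (beta : R) (gamma : \bar R) : set ('rV[int]_d -> R) :=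
  match gamma with
  | g%:E => G_fin beta g
  | +oo => \bigcap_(g in [set g : R | (0 < g)%R]) G_fin beta g
  | -oo => set0
  end%E.

(* For F in G_class beta gamma, "m is the number \bar F". When beta < 1 such an
   m is unique and does not depend on gamma: the average of F over the cubes
   [-L, L]^d (translated by z = 0) tends to m as L tends to +oo. *)
Definition has_Fbar (beta : R) (gamma : \bar R) (F : 'rV[int]_d -> R)
    (m : R) : Prop :=
  match gamma with
  | g%:E => average_bound beta g F m
  | +oo => forall g : R, (0 < g)%R -> average_bound beta g F m
  | -oo => False
  end%E.

End GlobalObservables.

Definition rho_exponent (R : realType) (d : nat) (beta : R) : R :=
  if beta <= (d%:R - 1) / d%:R then 1 / 2 else d%:R / 2 * (beta - 1) + 1.

(* For d = 1 and beta = 0 the exponent 2 / beta is read as +oo. *)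
Definition gamma_exponent (R : realType) (d : nat) (beta eps : R) : \bar R :=
  if d == 1%N then (if beta == 0 then +oo%E else (2 / beta)%:E)
  else (1 / eps)%:E.

(* Main.v *)
(** Let Q f(x) = E f(x + X_1).  Since the differences of the possible steps
generate Z^d, a score-function argument shows that Q^m f changes by at most
C |v| |f| / sqrt m under translation by v.  Comparing F with its averages over
cubes of side slightly below sqrt m, and iterating the comparison, gives
Q^m F = O(m^(d (beta - 1) / 2)) up to small powers of N, at all points within
distance N^(1/2 + delta) of the origin; smoothing once more gives a gradient
bound better by a factor sqrt m.  For u = sum_(m < N) Q^m F one has
F = u - Q u + Q^N F, so T_n is a martingale with increments
u(S_(i+1)) - Q u(S_i), up to boundary terms: the bounds on Q^m F control the
boundary terms and the gradient bound controls the variance, both at the scale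
N^rho.  Kolmogorov's maximal inequality at the dyadic times N = 2^k and the
Borel-Cantelli lemma conclude, so that only second moments of T_n are needed. *)

Require Import Defs.
From mathcomp Require Import all_boot all_order all_algebra finmap.
From mathcomp Require Import all_classical all_reals all_analysis.
From mathcomp Require Import measurable_realfun ring lra.

Set Implicit Arguments.
Unset Strict Implicit.
Unset Printing Implicit Defensive.

Import Order.TTheory GRing.Theory Num.Theory.
Import numFieldNormedType.Exports.

Local Open Scope classical_set_scope.
Local Open Scope ring_scope.

(** * Norms on Z^d and functions of quartic growth *)

Section SquareNorm.
Context {R : realType} {d : nat}.
Local Notation V := 'rV[int]_d.

(** The hypothesis controls averages only at points within a power of the side of the cube, so the
    decay obtained for Q^m F is not uniform in space. Bounds therefore have the form g + K |x|^2
    with K tiny. As the steps are centered, Q maps |x|^2 to |x|^2 + E |X_1|^2, so such bounds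
    survive many applications of Q, and the quadratic part stays negligible on the ball that the
    walk rarely leaves before time N. Put a = d (1 - beta) / 2, so that rho = max(1/2, 1 - a).
    Averages over cubes of side sqrt m are O(m^(- a)), which for m <= N is at most N^(rho - 1/2) /
    sqrt m. This form is the one propagated: its sum over m is of order N^rho, while the gradient
    bound N^(rho - 1/2) / m sums to N^(rho - 1/2) log N, so that N martingale increments have
    standard deviation of order N^rho log N. The spare eps in the exponent pays for the logarithm
    and for shortening the cubes, and leaves a negative power of N, hence a geometric series along N
    = 2^k. *)

Definition sqnorm (v : V) : R := \sum_(j < d) ((v ord0 j)%:~R : R) ^+ 2.

(** The length of a shortest lattice path from 0 to [v]; the cost of a translation accumulates along
    such a path. *)
Definition l1norm (v : V) : R := \sum_(j < d) `|(v ord0 j)%:~R : R|.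

Lemma sqnorm_ge0 (v : V) : 0 <= sqnorm v.
Proof. by apply: sumr_ge0 => j _; exact: sqr_ge0. Qed.

Lemma l1norm_ge0 (v : V) : 0 <= l1norm v.
Proof. exact: sumr_ge0. Qed.

(** Integers satisfy |n| <= n^2. The linear cost of a translation is thus absorbed into
    [1 + sqnorm v], the weight carried by the increments of the corrector. *)
Lemma l1norm_le_sqnorm (v : V) : l1norm v <= sqnorm v.
Proof.
apply: ler_sum => j _; set n := v ord0 j.
rewrite -intr_norm -rmorphXn ler_int.
have [->|n0] := eqVneq n 0; first by rewrite normr0 expr0n.
rewrite -(real_normK (num_real n)) expr2 ler_peMr //.
by rewrite -gtz0_ge1 normr_gt0.
Qed.

Lemma sqnormD (u v : V) : sqnorm (u + v) <= 2 * sqnorm u + 2 * sqnorm v.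
Proof.
rewrite /sqnorm !mulr_sumr -big_split /=; apply: ler_sum => j _.
rewrite mxE intrD; set x := (_)%:~R; set y := (_)%:~R.
by have := sqr_ge0 (x - y); lra.
Qed.

Lemma sqnorm_shift (u v : V) : 1 + sqnorm (u + v) <= 2 * (1 + sqnorm u) * (1 + sqnorm v).
Proof.
have := sqnormD u v; have := sqnorm_ge0 u; have := sqnorm_ge0 v.
move=> hv hu huv; have := mulr_ge0 hu hv; lra.
Qed.

Lemma enormE (v : V) : enorm R v ^+ 2 = sqnorm v.
Proof. by rewrite /enorm sqr_sqrtr // sqnorm_ge0. Qed.

(* Quartic growth, so that the square of a function bounded by [1 + sqnorm] is
   still integrable against the law of a step. *)
Definition grows (f : V -> R) : Prop :=
  exists C, forall v, `|f v| <= C * (1 + sqnorm v) ^+ 2.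

Lemma grows_const C0 (f : V -> R) : grows f ->
  exists2 C, 0 <= C & C0 <= C /\ forall v, `|f v| <= C * (1 + sqnorm v) ^+ 2.
Proof.
move=> [C hC]; exists (`|C| + `|C0|); first by rewrite addr_ge0.
split; first by rewrite (le_trans (ler_norm _))// lerDr.
move=> v; apply: le_trans (hC v) _; apply: ler_wpM2r; first exact: sqr_ge0.
by rewrite (le_trans (ler_norm _))// lerDl.
Qed.

Lemma le_grows (f g : V -> R) : (forall v, `|f v| <= g v) -> grows g -> grows f.
Proof.
move=> fg [C hC]; exists C => v; apply: le_trans (fg v) _.
exact: le_trans (ler_norm _) (hC v).
Qed.

Lemma one_le_sqnorm (v : V) : 1 <= (1 + sqnorm v) ^+ 2.
Proof. by rewrite exprn_ege1// lerDl sqnorm_ge0. Qed.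

Lemma bounded_grows (f : V -> R) B : (forall v, `|f v| <= B) -> grows f.
Proof.
move=> fB; exists B => v; apply: le_trans (fB v) _; apply: ler_peMr.
  exact: le_trans (normr_ge0 _) (fB v).
exact: one_le_sqnorm.
Qed.

Lemma grows_cst (c : R) : grows (fun=> c).
Proof. exact: (@bounded_grows _ `|c|). Qed.

Lemma growsD (f g : V -> R) : grows f -> grows g -> grows (fun v => f v + g v).
Proof.
move=> [C hC] [D hD]; exists (C + D) => v; rewrite mulrDl.
exact: le_trans (ler_normD _ _) (lerD (hC v) (hD v)).
Qed.

Lemma growsZ (a : R) (f : V -> R) : grows f -> grows (fun v => a * f v).
Proof.
move=> [C hC]; exists (`|a| * C) => v; rewrite normrM -mulrA.
exact: ler_wpM2l.
Qed.

Lemma growsN (f : V -> R) : grows f -> grows (fun v => - f v).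
Proof. by move=> [C hC]; exists C => v; rewrite normrN. Qed.

Lemma growsB (f g : V -> R) : grows f -> grows g -> grows (fun v => f v - g v).
Proof. by move=> hf hg; apply: growsD => //; exact: growsN. Qed.

Lemma grows_sum (I : Type) (r : seq I) (f : I -> V -> R) :
  (forall i, grows (f i)) -> grows (fun v => \sum_(i <- r) f i v).
Proof.
move=> hf; elim: r => [|i r IH].
  by rewrite (_ : (fun _ => _) = fun=> 0); [exact: grows_cst|apply/funext => v; rewrite big_nil].
rewrite (_ : (fun _ => _) = fun v => f i v + \sum_(j <- r) f j v); first exact: growsD.
by apply/funext => v; rewrite big_cons.
Qed.

Lemma grows_shift (f : V -> R) x : grows f -> grows (fun v => f (x + v)).
Proof.
move=> /(grows_const 0)[C C0 [_ hC]]; exists (C * (2 * (1 + sqnorm x)) ^+ 2) => v.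
apply: le_trans (hC _) _; rewrite -mulrA ler_wpM2l// -exprMn.
rewrite lerXn2r ?nnegrE ?sqnorm_shift//; last rewrite !mulr_ge0//.
all: by rewrite addr_ge0// sqnorm_ge0.
Qed.

Lemma grows_sqnorm2 : grows (fun v => (1 + sqnorm v) ^+ 2).
Proof. by exists 1 => v; rewrite mul1r ger0_norm// sqr_ge0. Qed.

Lemma grows_sqnorm : grows sqnorm.
Proof.
apply: le_grows grows_sqnorm2 => v; have := sqnorm_ge0 v => h.
by rewrite ger0_norm//; nra.
Qed.

Lemma grows_affine (g K : R) : grows (fun v => g + K * sqnorm v).
Proof. by apply: growsD; [exact: grows_cst|exact: growsZ grows_sqnorm]. Qed.

Lemma coord_le_sqnorm (j : 'I_d) (v : V) : ((v ord0 j)%:~R : R) ^+ 2 <= sqnorm v.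
Proof.
rewrite /sqnorm (bigD1 j)//= lerDl; apply: sumr_ge0 => i _; exact: sqr_ge0.
Qed.

Lemma grows_coord (j : 'I_d) : grows (fun v : V => (v ord0 j)%:~R).
Proof.
apply: le_grows grows_sqnorm => v; apply: le_trans (l1norm_le_sqnorm v).
by rewrite /l1norm (bigD1 j)//= lerDl; exact: sumr_ge0.
Qed.

End SquareNorm.

(** * The step operator and its powers *)

Section StepOperator.
Context {R : realType} {d : nat}.
Local Notation V := 'rV[int]_d.
Implicit Types (f g : V -> R) (x v z : V).

(** The expectation over one step, abstracted as a normalised positive linear functional on
    functions of quartic growth, so that the analytic part is free of integrability questions. *)
Record step_law (E : (V -> R) -> R) : Prop := StepLaw {
  step_lin : forall a f g, grows f -> grows g ->
    E (fun v => a * f v + g v) = a * E f + E g;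
  step_le : forall f g, grows f -> grows g -> (forall v, f v <= g v) -> E f <= E g;
  step_cst : forall c, E (fun=> c) = c;
  step_mean0 : forall j : 'I_d, E (fun v => (v ord0 j)%:~R) = 0 }.

Definition step_op (E : (V -> R) -> R) (f : V -> R) (x : V) : R :=
  E (fun v => f (x + v)).

Variables (E : (V -> R) -> R).
Hypothesis EP : step_law E.

Local Notation Q := (step_op E).

Lemma stepD f g : grows f -> grows g -> E (fun v => f v + g v) = E f + E g.
Proof.
move=> hf hg; rewrite -[E f]mul1r -(step_lin EP)//.
by congr E; apply/funext => v; rewrite mul1r.
Qed.

Lemma stepZ a f : grows f -> E (fun v => a * f v) = a * E f.
Proof.
move=> hf; have := step_lin EP a hf (grows_cst 0).
rewrite (step_cst EP) addr0 => <-.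
by congr E; apply/funext => v; rewrite addr0.
Qed.

Lemma stepN f : grows f -> E (fun v => - f v) = - E f.
Proof.
move=> hf; rewrite -mulN1r -stepZ//.
by congr E; apply/funext => v; rewrite mulN1r.
Qed.

Lemma stepB f g : grows f -> grows g -> E (fun v => f v - g v) = E f - E g.
Proof. by move=> hf hg; rewrite stepD ?stepN//; exact: growsN. Qed.

Lemma step_norm f g : grows g -> (forall v, `|f v| <= g v) -> `|E f| <= E g.
Proof.
move=> hg fg; have hf := le_grows fg hg.
rewrite ler_norml -stepN//; apply/andP; split; apply: (step_le EP) => //.
- exact: growsN.
- by move=> v; have := fg v; rewrite ler_norml => /andP[].
- by move=> v; have := fg v; rewrite ler_norml => /andP[].
Qed.

Lemma step_ge0 f : grows f -> (forall v, 0 <= f v) -> 0 <= E f.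
Proof. by move=> hf f0; rewrite -(step_cst EP 0); apply: (step_le EP) => //; exact: grows_cst. Qed.

Lemma op_grows f : grows f -> grows (Q f).
Proof.
move=> /(grows_const 0)[C C0 [_ hC]].
exists (C * 4 * E (fun v => (1 + sqnorm v) ^+ 2)) => x.
rewrite [leRHS](_ : _ = (C * 4 * (1 + sqnorm x) ^+ 2) * E (fun v => (1 + sqnorm v) ^+ 2)); last by rewrite mulrAC.
rewrite -stepZ; last exact: grows_sqnorm2.
apply: step_norm; first exact: growsZ grows_sqnorm2.
move=> v; apply: le_trans (hC _) _; rewrite -!mulrA ler_wpM2l//.
have := sqnorm_shift (R := R) x v; have := sqnorm_ge0 (R := R) v.
have := sqnorm_ge0 (R := R) x; have := sqnorm_ge0 (R := R) (x + v).
move=> h1 h2 h3 h4.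
rewrite [leRHS](_ : _ = (2 * (1 + sqnorm x) * (1 + sqnorm v)) ^+ 2); last by ring.
by rewrite lerXn2r ?nnegrE ?(le_trans _ h4) // ?addr_ge0.
Qed.

Lemma op_lin a f g x : grows f -> grows g ->
  Q (fun z => a * f z + g z) x = a * Q f x + Q g x.
Proof. by move=> hf hg; rewrite /step_op (step_lin EP)//; exact: grows_shift. Qed.

Lemma op_shift f x v : Q (fun z => f (z + v)) x = Q f (x + v).
Proof. by congr E; apply/funext => w; rewrite addrAC. Qed.

Lemma iter_grows n f : grows f -> grows (iter n Q f).
Proof. by move=> hf; elim: n => //= n IH; exact: op_grows. Qed.

Lemma iter_lin n a f g x : grows f -> grows g ->
  iter n Q (fun z => a * f z + g z) x = a * iter n Q f x + iter n Q g x.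
Proof.
move=> hf hg; elim: n x => //= n IH x.
by rewrite (_ : iter n Q _ = fun z => a * iter n Q f z + iter n Q g z);
  [rewrite op_lin//; exact: iter_grows|exact/funext].
Qed.

Lemma iter_shift n f x v : iter n Q (fun z => f (z + v)) x = iter n Q f (x + v).
Proof.
elim: n x => //= n IH x.
by rewrite (_ : iter n Q _ = fun z => iter n Q f (z + v)) ?op_shift//; exact/funext.
Qed.

Lemma iter_cst n c : iter n Q (fun=> c) = fun=> c.
Proof. by elim: n => //= n ->; apply/funext => x; rewrite /step_op (step_cst EP). Qed.

Lemma iter_opZ n a f x : grows f -> iter n Q (fun z => a * f z) x = a * iter n Q f x.
Proof.
move=> hf; have := iter_lin n a x hf (grows_cst 0).
rewrite iter_cst addr0 => <-.
by congr (iter n Q _ x); apply/funext => z; rewrite addr0.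
Qed.

Lemma iter_opD n f g x : grows f -> grows g ->
  iter n Q (fun z => f z + g z) x = iter n Q f x + iter n Q g x.
Proof.
move=> hf hg; have := iter_lin n 1 x hf hg; rewrite mul1r => <-.
by congr (iter n Q _ x); apply/funext => z; rewrite mul1r.
Qed.

Lemma iter_opB n f g x : grows f -> grows g ->
  iter n Q (fun z => f z - g z) x = iter n Q f x - iter n Q g x.
Proof.
move=> hf hg; have := iter_lin n (- 1) x hg hf; rewrite mulN1r addrC => <-.
by congr (iter n Q _ x); apply/funext => z; rewrite mulN1r addrC.
Qed.

Lemma iter_sum (I : Type) (r : seq I) n (f : I -> V -> R) x :
  (forall i, grows (f i)) ->
  iter n Q (fun z => \sum_(i <- r) f i z) x = \sum_(i <- r) iter n Q (f i) x.
Proof.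
move=> hf; elim: r => [|i r IH].
  rewrite big_nil (_ : (fun _ => _) = fun=> 0) ?iter_cst//.
  by apply/funext => z; rewrite big_nil.
rewrite big_cons -IH -iter_opD//; last exact: grows_sum.
by congr (iter n Q _ x); apply/funext => z; rewrite big_cons.
Qed.

Lemma iter_norm n f g x : grows g -> (forall z, `|f z| <= g z) ->
  `|iter n Q f x| <= iter n Q g x.
Proof.
move=> hg fg; elim: n x => [//|n IH] x /=; apply: step_norm => //.
exact/grows_shift/iter_grows.
Qed.

Lemma iter_bound n f B x : (forall z, `|f z| <= B) -> `|iter n Q f x| <= B.
Proof.
by move=> fB; have := iter_norm n x (grows_cst B) fB; rewrite iter_cst.
Qed.

Lemma step_sqnorm_shift x : E (fun v => sqnorm (x + v)) = sqnorm x + E sqnorm.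
Proof.
rewrite (_ : (fun v => sqnorm (x + v)) =
  fun v => (\sum_(j < d) (2 * (x ord0 j)%:~R) * (v ord0 j)%:~R) + (sqnorm x + sqnorm v)).
  rewrite stepD; last 2 first.
  - by apply: grows_sum => j; exact/growsZ/grows_coord.
  - by apply: growsD; [exact: grows_cst|exact: grows_sqnorm].
  rewrite stepD ?(step_cst EP); [|exact: grows_cst|exact: grows_sqnorm].
  rewrite (_ : E _ = 0) ?add0r//.
  elim: (index_enum _) => [|j r IH].
    by rewrite (_ : (fun _ => _) = fun=> 0) ?(step_cst EP)//; apply/funext => v; rewrite big_nil.
  rewrite (_ : (fun _ => _) = fun v => 2 * (x ord0 j)%:~R * (v ord0 j)%:~R +
     \sum_(i <- r) 2 * (x ord0 i)%:~R * (v ord0 i)%:~R).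
    rewrite (step_lin EP) ?IH ?(step_mean0 EP) ?mulr0 ?addr0//; first exact: grows_coord.
    by apply: grows_sum => i; exact/growsZ/grows_coord.
  by apply/funext => v; rewrite big_cons.
apply/funext => v; rewrite /sqnorm -!big_split /=; apply: eq_bigr => j _.
by rewrite mxE intrD; ring.
Qed.

(** The cross term of |x + v|^2 has mean zero, so each application adds exactly [K * E sqnorm]. This
    linear growth keeps a bound that is good only near the origin usable after many steps. *)
Lemma iter_affine n (g K : R) x :
  iter n Q (fun z => g + K * sqnorm z) x = g + K * (sqnorm x + n%:R * E sqnorm).
Proof.
elim: n x => [|n IH] x; first by rewrite mul0r addr0.
rewrite iterS /step_op (_ : (fun v => _) =
  fun v => (g + K * (n%:R * E sqnorm)) + K * sqnorm (x + v)); last first.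
  by apply/funext => v; rewrite IH; ring.
rewrite stepD ?stepZ ?(step_cst EP) ?step_sqnorm_shift; first by rewrite -natr1; ring.
- exact/grows_shift/grows_sqnorm.
- exact: grows_cst.
- exact/growsZ/grows_shift/grows_sqnorm.
Qed.

End StepOperator.

(** * Smoothing by the score function *)

Section Smoothing.
Context {R : realType} {d : nat}.
Local Notation V := 'rV[int]_d.
Implicit Types (f g : V -> R) (x y u v z : V).

Variables (E : (V -> R) -> R).
Hypothesis EP : step_law E.

Local Notation Q := (step_op E).

Definition step_mass x : R := E (fun v => (v == x)%:R).

(** The derivative at t = 0 of the log-likelihood of [v] when the law p of a step is perturbed to p
    + t (delta_x - delta_y). *)
Definition score x y v : R :=
  (v == x)%:R / step_mass x - (v == y)%:R / step_mass y.

Lemma step_indic x g : E (fun v => (v == x)%:R * g v) = g x * step_mass x.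
Proof.
rewrite (_ : (fun _ => _) = fun v => g x * (v == x)%:R).
  rewrite (stepZ EP)//; apply: (@bounded_grows _ _ _ 1) => v.
  by rewrite ger0_norm// lern1 leq_b1.
by apply/funext => v; case: eqP => [->|]; rewrite ?mulr0 ?mul0r ?mulr1 ?mul1r.
Qed.

Lemma score_bound x y v : `|score x y v| <= `|(step_mass x)^-1| + `|(step_mass y)^-1|.
Proof.
apply: le_trans (ler_normB _ _) _; rewrite !normrM.
by apply: lerD; apply: ler_piMl => //; case: eqP; rewrite ?normr1 ?normr0.
Qed.

Lemma grows_score x y g B : (forall v, `|g v| <= B) -> grows (fun v => score x y v * g v).
Proof.
move=> gB; pose b := `|(step_mass x)^-1| + `|(step_mass y)^-1|.
apply: (@bounded_grows _ _ _ (b * B)) => v; rewrite normrM.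
by apply: ler_pM => //; exact: score_bound.
Qed.

Lemma step_score x y g : step_mass x != 0 -> step_mass y != 0 ->
  E (fun v => score x y v * g v) = g x - g y.
Proof.
move=> px py.
have gi z : grows (fun v => (v == z)%:R * g v).
  apply: (@bounded_grows _ _ _ `|g z|) => v.
  by case: eqP => [->|_]; rewrite ?mul1r ?mul0r ?normr0.
rewrite (_ : (fun _ => _) = fun v => (step_mass x)^-1 * ((v == x)%:R * g v) -
                                     (step_mass y)^-1 * ((v == y)%:R * g v)).
  rewrite (stepB EP) ?(stepZ EP) ?step_indic//; try exact: growsZ.
  by rewrite !(mulrC _ (_ * step_mass _)) !mulfK.
by apply/funext => v; rewrite /score; ring.
Qed.

(* Replacing one of [m] steps equal to [x] by [y] costs the average of [m]
   centered i.i.d. scores; by Cauchy-Schwarz, in the form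
   [2 |a b| <= a^2 / t + t b^2], this is of order [m ^ (-1/2)]. *)
Lemma score_induction x y f B m z (s t : R) :
  step_mass x != 0 -> step_mass y != 0 -> (forall v, `|f v| <= B) -> 0 < t ->
  `|s * iter m Q f z + m%:R * (iter m.-1 Q f (z + x) - iter m.-1 Q f (z + y))| <=
  B * ((s ^+ 2 + m%:R * E (fun v => score x y v ^+ 2)) / (2 * t) + t / 2).
Proof.
move=> px py fB t0; set c := E _.
have B0 : 0 <= B by exact: le_trans (normr_ge0 _) (fB 0).
have Qb n w : `|iter n Q f w| <= B by exact: iter_bound.
have Qg n : grows (iter n Q f) by exact: bounded_grows (Qb n).
have h1 : grows (score x y).
  by rewrite (_ : score x y = fun v => score x y v * 1);
    [apply: (@grows_score _ _ _ 1) => _; rewrite normr1|apply/funext => v; rewrite mulr1].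
have h2 : grows (fun v => score x y v ^+ 2).
  under [X in grows X]funext do rewrite expr2.
  by apply: grows_score; exact: score_bound.
(* [s] stands for the score of the steps already taken. Conditioning on the first remaining step
   turns it into [s + score x y v]; the score has mean zero, so s^2 increases by [c] on average. *)
elim: m z s => [|m IH] z s.
  rewrite !mul0r !addr0 normrM /= mulrC ler_pM//.
  rewrite -subr_ge0 -[leRHS](_ : (`|s| - t) ^+ 2 / (2 * t) = _).
    by rewrite divr_ge0 ?sqr_ge0// mulr_ge0// ltW.
  by rewrite -(real_normK (num_real s)); field; exact: lt0r_neq0.
pose G v := (s + score x y v) * iter m Q f (z + v) +
  m%:R * (iter m.-1 Q f (z + v + x) - iter m.-1 Q f (z + v + y)).
have gx n w u : grows (fun v => iter n Q f (w + v + u)).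
  by apply: (bounded_grows (B := B)) => v; exact: Qb.
have gs n w : grows (fun v => iter n Q f (w + v)).
  by apply: (bounded_grows (B := B)) => v; exact: Qb.
have gsc : grows (fun v => score x y v * iter m Q f (z + v)).
  by apply: (@grows_score _ _ _ B) => v; exact: Qb.
(* For m = 0 the two expectations may differ, since [m.-1] is again 0; the factor m removes this
   case. *)
have ED u : m%:R * E (fun v => iter m.-1 Q f (z + v + u)) = m%:R * iter m Q f (z + u).
  case: m {IH G gsc} => [|m]; first by rewrite !mul0r.
  by congr (_ * _); exact: (op_shift E (iter m Q f) z u).
have -> : s * iter m.+1 Q f z +
    m.+1%:R * (iter m.+1.-1 Q f (z + x) - iter m.+1.-1 Q f (z + y)) = E G.
  rewrite (_ : G = fun v => (s * iter m Q f (z + v) + score x y v * iter m Q f (z + v)) +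
    m%:R * (iter m.-1 Q f (z + v + x) - iter m.-1 Q f (z + v + y))); last first.
    by apply/funext => v; rewrite /G mulrDl.
  rewrite (stepD EP); last 2 first.
  - by apply: growsD => //; exact: growsZ.
  - by apply: growsZ; exact: growsB.
  rewrite (step_lin EP)// (stepZ EP); last exact: growsB.
  rewrite (stepB EP)// [in RHS]mulrBr !ED (step_score (fun v => iter m Q f (z + v)))//.
  by rewrite -[in LHS]natr1 /= /step_op; ring.
have gb (k : R) : grows (fun v => B * (((s + score x y v) ^+ 2 + k) / (2 * t) + t / 2)).
  rewrite (_ : (fun _ => _) = fun v => B / (2 * t) * (score x y v ^+ 2) +
    ((B / (2 * t) * (2 * s)) * score x y v + B * ((s ^+ 2 + k) / (2 * t) + t / 2))).
    apply: growsD; first exact: growsZ.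
    by apply: growsD; [exact: growsZ|exact: grows_cst].
  by apply/funext => v; rewrite !(expr2 _) ?invfM; ring.
apply: le_trans (step_norm EP (gb _) _) _.
  by move=> v; exact: (IH (z + v) (s + score x y v)).
have Es : E (score x y) = 0.
  rewrite -[RHS](subrr (1 : R)) -(step_score (fun=> 1) px py).
  by congr E; apply/funext => v; rewrite mulr1.
rewrite (_ : (fun _ => _) = fun v => B / (2 * t) * (score x y v ^+ 2) +
    ((B / (2 * t) * (2 * s)) * score x y v +
      B * ((s ^+ 2 + m%:R * c) / (2 * t) + t / 2))); last first.
  by apply/funext => v; rewrite !(expr2 _) ?invfM; ring.
rewrite (step_lin EP)//; last by apply: growsD; [exact: growsZ|exact: grows_cst].
rewrite (step_lin EP)//; last exact: grows_cst.
rewrite (step_cst EP) Es mulr0 add0r -/c -[m.+1%:R]natr1.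
by rewrite le_eqVlt; apply/orP; left; apply/eqP; rewrite !invfM; ring.
Qed.

Definition smoothing v (C : R) : Prop := forall f B, (forall z, `|f z| <= B) ->
  forall n z, `|iter n Q f (z + v) - iter n Q f z| <= C * B / Num.sqrt n.+1%:R.

Lemma smoothing_score x y : step_mass x != 0 -> step_mass y != 0 ->
  exists C, smoothing (x - y) C.
Proof.
move=> px py; exists ((E (fun v => score x y v ^+ 2) + 1) / 2) => f B fB n z.
(* With s = 0 and m = n + 1 the bound is B (m c / (2 t) + t / 2). The choice t = sqrt m balances its
   terms, and division by m leaves B (c + 1) / (2 sqrt m). *)
have := @score_induction x y f B n.+1 (z - y) 0 (Num.sqrt n.+1%:R) px py fB.
rewrite sqrtr_gt0 ltr0n => /(_ isT).
rewrite mul0r add0r expr0n add0r normrM ger0_norm// -ler_pdivlMl ?ltr0n// addrAC subrK.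
rewrite addrAC [z + (x - y)]addrA addrAC => /le_trans; apply.
set q := Num.sqrt _; have q0 : 0 < q by rewrite sqrtr_gt0 ltr0n.
rewrite -[n.+1%:R](@sqr_sqrtr R)// -/q.
rewrite le_eqVlt; apply/orP; left; apply/eqP; field; exact: lt0r_neq0.
Qed.

Lemma smoothing0 : smoothing 0 0.
Proof. by move=> f B fB n z; rewrite addr0 subrr normr0 !mul0r. Qed.

Lemma smoothingD u v C D : smoothing u C -> smoothing v D -> smoothing (u + v) (C + D).
Proof.
move=> hu hv f B fB n z; rewrite !mulrDl.
rewrite addrA -(subrK (iter n Q f (z + u)) (iter n Q f (z + u + v))) -addrA.
by rewrite [leRHS]addrC; apply: le_trans (ler_normD _ _) (lerD _ _); [exact: hv|exact: hu].
Qed.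

Lemma smoothingN v C : smoothing v C -> smoothing (- v) C.
Proof.
move=> hv f B fB n z; have := hv _ _ fB n (z - v).
by rewrite subrK distrC.
Qed.

Lemma smoothing_mulz v C (k : int) : smoothing v C -> smoothing (v *~ k) (`|k|%:~R * C).
Proof.
move=> hv; have nat_case n : smoothing (v *+ n) (n%:R * C).
  elim: n => [|n IH]; first by rewrite mulr0n mul0r; exact: smoothing0.
  by rewrite mulrSr -natr1 mulrDl mul1r; exact: smoothingD.
case: k => n; first exact: nat_case.
rewrite NegzE mulrNz normrN; apply: smoothingN; exact: (nat_case n.+1).
Qed.

Lemma smoothing_sum (I : Type) (r : seq I) (v : I -> V) (C : I -> R) :
  (forall i, smoothing (v i) (C i)) ->
  smoothing (\sum_(i <- r) v i) (\sum_(i <- r) C i).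
Proof.
move=> h; elim: r => [|i r IH]; first by rewrite !big_nil; exact: smoothing0.
by rewrite !big_cons; exact: smoothingD.
Qed.

Lemma smoothing_le v C D : C <= D -> smoothing v C -> smoothing v D.
Proof.
move=> CD h f B fB n z; apply: le_trans (h _ _ fB n z) _.
rewrite ler_wpM2r ?invr_ge0 ?sqrtr_ge0// ler_wpM2r//.
exact: le_trans (normr_ge0 _) (fB 0).
Qed.

Lemma smoothing_l1norm : (forall v, exists C, smoothing v C) ->
  exists2 C, 0 <= C & forall v, smoothing v (C * l1norm v).
Proof.
move=> h; have [c hc] : {c : 'I_d -> R & forall j, smoothing (delta_mx ord0 j) (c j)}.
  apply: (@choice _ _ (fun j c => smoothing (delta_mx ord0 j) c)) => j; exact: h.
exists (\sum_j `|c j|) => [|v]; first exact: sumr_ge0.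
rewrite {1}(row_sum_delta v) /l1norm mulr_sumr.
apply: smoothing_sum => j; rewrite -[X in X *: _]intz scaler_int.
apply: (smoothing_le _ (smoothing_mulz (v ord0 j) (hc j))).
rewrite mulrC intr_norm ler_wpM2r// (le_trans (ler_norm _))//.
by rewrite (bigD1 j)//= lerDl; exact: sumr_ge0.
Qed.

Definition smoothable : set V := [set v | exists C, smoothing v C].

Lemma smoothable_subgroup : is_subgroup smoothable.
Proof.
split; first by exists 0; exact: smoothing0.
move=> u v [C hC] [D hD]; exists (C + D).
by apply: smoothingD => //; exact: smoothingN.
Qed.

End Smoothing.

(** * Averages over finite sets of translations *)

Section Averaging.
Context {R : realType} {d : nat}.
Local Notation V := 'rV[int]_d.
Implicit Types (f g : V -> R) (x y u v z : V) (s : seq V).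

Definition shift_avg s f z : R := (\sum_(v <- s) f (z + v)) / (size s)%:R.

Definition shift_diff s f z : R := f z - shift_avg s f z.

Variables (E : (V -> R) -> R).
Hypothesis EP : step_law E.

Local Notation Q := (step_op E).

Lemma sum_le_const s (h : V -> R) c : (forall v, v \in s -> `|h v| <= c) ->
  `|\sum_(v <- s) h v| <= c * (size s)%:R.
Proof.
move=> hc; apply: le_trans (ler_norm_sum _ _ _) _.
rewrite big_seq; apply: le_trans (ler_sum _ (fun v vs => hc v vs)) _.
by rewrite -big_seq big_const_seq count_predT iter_addr_0 mulr_natr.
Qed.

Lemma shift_avg_norm s f z c : (0 < size s)%N -> (forall v, v \in s -> `|f (z + v)| <= c) ->
  `|shift_avg s f z| <= c.
Proof.
move=> s0 fc; rewrite normrM normfV (ger0_norm (ler0n _ _)) ler_pdivrMr ?ltr0n//.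
exact: sum_le_const.
Qed.

Lemma grows_shiftr f v : grows f -> grows (fun z => f (z + v)).
Proof. by move=> /(@grows_shift _ _ _ v); under eq_fun do rewrite addrC. Qed.

Lemma grows_avg s f : grows f -> grows (shift_avg s f).
Proof.
move=> hf; have : grows (fun z => (size s)%:R^-1 * \sum_(v <- s) f (z + v)).
  by apply: growsZ; apply: grows_sum => v; exact: grows_shiftr.
by rewrite (_ : (fun _ => _) = shift_avg s f)//; apply/funext => z; rewrite mulrC.
Qed.

Lemma grows_diff s f : grows f -> grows (shift_diff s f).
Proof. by move=> hf; apply: growsB => //; exact: grows_avg. Qed.

Lemma grows_iter_diff s n f : grows f -> grows (iter n (shift_diff s) f).
Proof. by move=> hf; elim: n => //= n IH; exact: grows_diff. Qed.

Lemma iter_avg s n f x : grows f ->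
  iter n Q (shift_avg s f) x = shift_avg s (iter n Q f) x.
Proof.
move=> hf; rewrite (_ : shift_avg s f = fun z => (size s)%:R^-1 * \sum_(v <- s) f (z + v)).
  rewrite (iter_opZ EP); last by apply: grows_sum => v; exact: grows_shiftr.
  rewrite (iter_sum EP); last by move=> v; exact: grows_shiftr.
  by rewrite mulrC; congr (_ * _); apply: eq_bigr => v _; rewrite iter_shift.
by apply/funext => z; rewrite mulrC.
Qed.

Lemma iter_shift_diff s n f x : grows f ->
  iter n Q (shift_diff s f) x = shift_diff s (iter n Q f) x.
Proof. by move=> hf; rewrite (iter_opB EP) ?iter_avg//; exact: grows_avg. Qed.

Lemma shift_diffE s f z : (0 < size s)%N ->
  shift_diff s f z = - (\sum_(v <- s) (f (z + v) - f z)) / (size s)%:R.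
Proof.
move=> s0; rewrite sumrB big_const_seq count_predT iter_addr_0 /shift_diff /shift_avg.
by rewrite -mulr_natr; field; rewrite pnatr_eq0 -lt0n.
Qed.

Lemma shift_diff_smoothing s C l f B n z : (0 < size s)%N -> 0 <= C ->
  (forall v, smoothing E v (C * l1norm v)) ->
  (forall v, v \in s -> l1norm v <= l) -> (forall z, `|f z| <= B) ->
  `|iter n Q (shift_diff s f) z| <= C * l / Num.sqrt n.+1%:R * B.
Proof.
move=> s0 C0 hC hl fB; have B0 : 0 <= B by exact: le_trans (normr_ge0 _) (fB 0).
rewrite iter_shift_diff ?shift_diffE//; last exact: bounded_grows fB.
rewrite mulNr normrN normrM normfV (ger0_norm (ler0n _ _)) ler_pdivrMr ?ltr0n//.
apply: sum_le_const => v /hl vl; apply: le_trans (hC v _ _ fB _ _) _.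
rewrite mulrAC ler_wpM2r// ler_wpM2r ?invr_ge0 ?sqrtr_ge0//.
exact: ler_wpM2l.
Qed.

(** Q commutes with translations, hence with the operator D = [shift_diff s], so Q^(n k) D^k = (Q^n
    D)^k and each block of n steps yields one factor. *)
Lemma iter_diff_smoothing s C l f B n k z : (0 < size s)%N -> 0 <= C ->
  (forall v, smoothing E v (C * l1norm v)) ->
  (forall v, v \in s -> l1norm v <= l) -> (forall z, `|f z| <= B) ->
  `|iter (n * k) Q (iter k (shift_diff s) f) z| <= (C * l / Num.sqrt n.+1%:R) ^+ k * B.
Proof.
move=> s0 C0 hC hl fB; have fg : grows f by exact: bounded_grows fB.
elim: k z => [|k IH] z; first by rewrite muln0 expr0 mul1r.
rewrite mulnS iterD iterS.
rewrite (_ : iter (n * k) Q _ =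
    shift_diff s (iter (n * k) Q (iter k (shift_diff s) f))); last first.
  by apply/funext => w; rewrite iter_shift_diff//; exact: grows_iter_diff.
apply: le_trans (shift_diff_smoothing _ _ s0 C0 hC hl IH) _.
by rewrite mulrA -exprS.
Qed.

Lemma shift_diff_affine s f (g K r : R) z : (0 < size s)%N -> 0 <= K ->
  (forall v, v \in s -> sqnorm v <= r) -> (forall z, `|f z| <= g + K * sqnorm z) ->
  `|shift_diff s f z| <= 2 * g + 2 * K * r + 3 * K * sqnorm z.
Proof.
move=> s0 K0 hr hf; apply: le_trans (ler_normB _ _) _.
rewrite [leRHS](_ : _ = (g + K * sqnorm z) + (g + K * (2 * sqnorm z + 2 * r))); last by ring.
apply: lerD => //; apply: shift_avg_norm => // v vs.
apply: le_trans (hf _) _; rewrite lerD2l ler_wpM2l//.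
apply: le_trans (sqnormD _ _) _; rewrite lerD2l ler_wpM2l//; exact: hr.
Qed.

(** One application multiplies the coefficient of [sqnorm] by 3 = 1 + 2, the 2 coming from
    [sqnormD], and, relative to 3^i, turns the constant c into 2 c + 2 K r. The term 2 K r is the
    solution of 2 c + 2 K r = 3 c. *)
Lemma iter_diff_affine s f (g K r : R) i z : (0 < size s)%N -> 0 <= g -> 0 <= K ->
  (forall v, v \in s -> sqnorm v <= r) -> (forall z, `|f z| <= g + K * sqnorm z) ->
  `|iter i (shift_diff s) f z| <= 3 ^+ i * (g + 2 * K * r + K * sqnorm z).
Proof.
move=> s0 g0 K0 hr hf.
have r0 : 0 <= r.
  by case: s s0 hr {hf} => // v s _ /(_ v (mem_head _ _)); exact/le_trans/sqnorm_ge0.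
have Kr := mulr_ge0 K0 r0.
elim: i z => [|i IH] z.
  by rewrite expr0 mul1r; apply: le_trans (hf z) _; lra.
have e : forall z, `|iter i (shift_diff s) f z| <=
    3 ^+ i * (g + 2 * K * r) + (3 ^+ i * K) * sqnorm z.
  by move=> w; apply: le_trans (IH w) _; rewrite mulrDr !mulrA.
have p0 : 0 <= 3 ^+ i :> R by exact: exprn_ge0.
apply: le_trans (shift_diff_affine z s0 (mulr_ge0 p0 K0) hr e) _.
rewrite exprS -subr_ge0.
rewrite (_ : _ - _ = 3 ^+ i * g); first exact: mulr_ge0.
ring.
Qed.

Lemma iter_diffB s n f g z :
  iter n (shift_diff s) (fun x => f x - g x) z =
  iter n (shift_diff s) f z - iter n (shift_diff s) g z.
Proof.
elim: n z => // n IH z; rewrite !iterS.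
rewrite (_ : iter n _ (fun x => _) = fun x => iter n (shift_diff s) f x -
  iter n (shift_diff s) g x); last exact/funext.
by rewrite /shift_diff /shift_avg sumrB; ring.
Qed.

Lemma telescope_diff s k f z :
  f z = \sum_(i < k) iter i (shift_diff s) (shift_avg s f) z + iter k (shift_diff s) f z.
Proof.
elim: k => [|k IH]; first by rewrite big_ord0 add0r.
rewrite big_ord_recr /= [LHS]IH -addrA; congr (_ + _).
rewrite -iterS iterSr; apply/eqP; rewrite -subr_eq -iter_diffB; apply/eqP.
by congr (iter k _ _ z); apply/funext => x; rewrite /shift_diff; ring.
Qed.

(* With A the average over [s],
     f = sum_(i < k) (1 - A)^i A f + (1 - A)^k f.
   Each of the [k] factors [1 - A] of the last term is absorbed by [n] steps of
   the walk, uniformly in space; only the terms containing A f see the bound that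
   degrades with the distance to the origin. *)
Lemma avg_decay s C l f B (g K r : R) n k m x : (0 < size s)%N -> 0 <= C -> 0 <= g -> 0 <= K ->
  (forall v, smoothing E v (C * l1norm v)) ->
  (forall v, v \in s -> l1norm v <= l /\ sqnorm v <= r) ->
  (forall z, `|f z| <= B) ->
  (forall z, `|shift_avg s f z| <= g + K * sqnorm z) -> (n * k <= m)%N ->
  `|iter m Q f x| <= (C * l / Num.sqrt n.+1%:R) ^+ k * B +
    3 ^+ k * (g + 2 * K * r + K * (sqnorm x + m%:R * E sqnorm)).
Proof.
move=> s0 C0 g0 K0 hC hs fB hA nkm.
have fg : grows f by exact: bounded_grows fB.
have ig i : grows (iter i (shift_diff s) (shift_avg s f)).
  exact/grows_iter_diff/grows_avg.
rewrite (_ : f = fun z => \sum_(i < k) iter i (shift_diff s) (shift_avg s f) z +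
  iter k (shift_diff s) f z); last by apply/funext => z; exact: telescope_diff.
rewrite (iter_opD EP); [|exact: grows_sum|exact: grows_iter_diff].
rewrite addrC; apply: le_trans (ler_normD _ _) (lerD _ _).
  rewrite -(subnK nkm) iterD; apply: (iter_bound EP) => w.
  by apply: iter_diff_smoothing => // v /hs[].
rewrite (iter_sum EP)//.
apply: le_trans (ler_norm_sum _ _ _) _.
set W := g + _ + _.
have W0 : 0 <= W.
  have r0 : 0 <= r.
    by case: s s0 hs {hA ig} => // v s _ /(_ v (mem_head _ _))[_]; exact/le_trans/sqnorm_ge0.
  rewrite !addr_ge0 ?mulr_ge0 ?addr_ge0 ?mulr_ge0 ?sqnorm_ge0//.
  by apply: (step_ge0 EP); [exact: grows_sqnorm|exact: sqnorm_ge0].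
have each i : `|iter m Q (iter i (shift_diff s) (shift_avg s f)) x| <= 3 ^+ i * W.
  have aff z : `|iter i (shift_diff s) (shift_avg s f) z| <=
      3 ^+ i * (g + 2 * K * r) + 3 ^+ i * K * sqnorm z.
    rewrite [leRHS](_ : _ = 3 ^+ i * (g + 2 * K * r + K * sqnorm z)); last by ring.
    by apply: iter_diff_affine => // v /hs[].
  apply: le_trans (iter_norm EP m x (grows_affine _ _) aff) _.
  by rewrite (iter_affine EP) /W le_eqVlt; apply/orP; left; apply/eqP; ring.
apply: le_trans (ler_sum _ (fun (i : 'I_k) _ => each i)) _.
rewrite -mulr_suml ler_wpM2r//.
elim: k {fg ig each nkm} => [|k IH]; first by rewrite big_ord0.
rewrite big_ord_recr /= exprS.
have p : 0 <= 3 ^+ k :> R by exact: exprn_ge0.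
lra.
Qed.

(** Smoothing needs a uniform bound, so f is truncated at height g. The truncated part gains the
    square root; the excess is at most K |z|^2 and is propagated without any gain, its coefficient
    being small in the application. *)
Lemma smoothing_affine v C f (g K : R) n x : 0 <= g -> 0 <= K -> smoothing E v C ->
  (forall z, `|f z| <= g + K * sqnorm z) ->
  `|iter n Q f (x + v) - iter n Q f x| <= C * g / Num.sqrt n.+1%:R +
    K * (sqnorm (x + v) + sqnorm x + 2 * n%:R * E sqnorm).
Proof.
move=> g0 K0 hv hf; pose f1 z := Num.max (- g) (Num.min g (f z)).
have f1g z : `|f1 z| <= g by rewrite ler_norml /f1 !maxEle !minEle; do !case: ifPn; lra.
have f2K z : `|f z - f1 z| <= 0 + K * sqnorm z.
  have := hf z; have := mulr_ge0 K0 (sqnorm_ge0 z); rewrite /f1 !ler_norml !maxEle !minEle.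
  move: (K * _) => k k0 /andP[h1 h2]; do !case: ifPn; lra.
have gf1 : grows f1 by exact: bounded_grows f1g.
have gf2 : grows (fun z => f z - f1 z) by exact: le_grows f2K (grows_affine _ _).
rewrite (_ : f = fun z => f1 z + (f z - f1 z)); last by apply/funext => z; ring.
rewrite !(iter_opD EP n _ gf1 gf2) opprD addrACA.
apply: le_trans (ler_normD _ _) (lerD (hv _ _ f1g n x) _).
apply: le_trans (ler_normB _ _) _.
have h z := iter_norm EP n z (grows_affine 0 K) f2K.
apply: le_trans (lerD (h _) (h _)) _.
rewrite !(iter_affine EP) !add0r.
by rewrite le_eqVlt; apply/orP; left; apply/eqP; ring.
Qed.

End Averaging.

(** * Decay of the powers of the step operator *)

Section Decay.
Context {R : realType} {d : nat}.
Local Notation V := 'rV[int]_d.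
Implicit Types (x z : V).

Variables (E : (V -> R) -> R) (C : R) (F : V -> R) (B : R) (box : nat -> seq V).
Variables (CA a gamma : R).
Hypotheses (EP : step_law E) (C0 : 0 <= C)
  (smooth : forall v, smoothing E v (C * l1norm v))
  (F_bound : forall z, `|F z| <= B)
  (size_box : forall l, (0 < size (box l))%N)
  (mem_box : forall l v, v \in box l ->
    l1norm v <= d%:R * l%:R :> R /\ sqnorm v <= d%:R * l%:R ^+ 2 :> R)
  (a_ge0 : 0 <= a) (gamma_ge0 : 0 <= gamma) (CA0 : 0 <= CA)
  (F_avg : forall l z, (0 < l)%N -> sqnorm z < (l%:R `^ gamma) ^+ 2 ->
    `|shift_avg (box l) F z| <= CA * l%:R `^ (- (2 * a))).

Local Notation Q := (step_op E).

Let B0 : 0 <= B. Proof. exact: le_trans (normr_ge0 _) (F_bound 0). Qed.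

(** Within distance l^gamma the hypothesis on averages applies. Farther away |z| >= l^gamma >= N^(1
    - delta), so the trivial bound B is itself at most B N^(- 2 (1 - delta)) |z|^2. *)
Lemma box_avg_affine (N : R) kappa delta l z : 1 <= N -> (0 < l)%N ->
  1 - delta <= kappa * gamma -> N `^ kappa <= l%:R ->
  `|shift_avg (box l) F z| <=
    CA * l%:R `^ (- (2 * a)) + B * N `^ (- (2 * (1 - delta))) * sqnorm z.
Proof.
move=> N1 l0 kg Nl; set g := CA * _; have g0 : 0 <= g by rewrite mulr_ge0// powR_ge0.
have [zl|lz] := ltP (sqnorm z) ((l%:R `^ gamma) ^+ 2).
  by rewrite -[leLHS]addr0 lerD ?F_avg// !mulr_ge0 ?powR_ge0 ?sqnorm_ge0.
rewrite -[leLHS]add0r lerD//.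
have avgB : `|shift_avg (box l) F z| <= B by exact: shift_avg_norm.
apply: le_trans avgB _; rewrite -mulrA ler_peMr//.
have N0 : 0 < N by rewrite (lt_le_trans _ N1).
rewrite powRN mulrC ler_pdivlMr ?powR_gt0// mul1r; apply: le_trans lz.
rewrite mulrC powRrM powR_mulrn ?powR_ge0//.
rewrite lerXn2r ?nnegrE ?powR_ge0//.
apply: le_trans (ler_powR N1 kg) _; rewrite powRrM.
by rewrite ge0_ler_powR// ?nnegrE ?powR_ge0 ?ler0n.
Qed.

(* While [sqrt m <= 2 N ^ (kappa + zeta)] the trivial bound is good enough.
   Afterwards, cubes of side [sqrt m * N ^ (- zeta) >= N ^ kappa] are used: every
   smoothing step then gains a factor [N ^ (- zeta)], and [k >= a / zeta] of them
   make the remainder smaller than the averages. *)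
Lemma iter_decay (kappa zeta theta delta : R) :
  0 <= kappa -> 0 < zeta -> kappa + zeta <= theta ->
  2^-1 - a + 2 * a * zeta <= theta -> 2 * a * zeta <= theta ->
  1 - delta <= kappa * gamma ->
  exists2 K, 0 <= K & forall N m x, (0 < m <= N)%N ->
    `|iter m Q F x| <= K * (N%:R `^ theta / Num.sqrt m%:R +
       N%:R `^ (- (2 * (1 - delta))) * (sqnorm x + N%:R)).
Proof.
move=> k0 z0 kz1 az1 az2 kg.
pose k := (Num.truncn (a / zeta)).+1.
have kzeta : a <= k%:R * zeta by rewrite -ler_pdivrMr// ltW// truncnS_gt.
(* [K1] is for the smoothed remainder: blocks of m / k steps cost sqrt k each. [K2] is for the
   averages: 4^a comes from rounding the side y down to l >= y / 2 in l^(- 2 a). [K3] is for the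
   quadratic error. *)
pose K1 := (C * d%:R * Num.sqrt k%:R) ^+ k * B.
pose K2 := 3 ^+ k * CA * 4 `^ a.
pose K3 := 3 ^+ k * B * (2 * d%:R + 1 + E sqnorm).
have s20 : 0 <= E sqnorm by apply: (step_ge0 EP); [exact: grows_sqnorm|exact: sqnorm_ge0].
have K10 : 0 <= K1 by rewrite mulr_ge0 ?exprn_ge0// !mulr_ge0 ?sqrtr_ge0.
have K20 : 0 <= K2 by rewrite !mulr_ge0 ?powR_ge0 ?exprn_ge0.
have K30 : 0 <= K3 by rewrite mulr_ge0 ?addr_ge0 ?mulr_ge0 ?exprn_ge0.
exists (2 * B + (K1 + K2) + K3); first by rewrite !addr_ge0// mulr_ge0.
move=> N m x /andP[m0 mN].
set T1 := _ / _; set KN := N%:R `^ (- _); set T2 := KN * _.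
have n1 : 1 <= N%:R :> R by rewrite ler1n (leq_trans m0).
have n0 : 0 < N%:R :> R by rewrite (lt_le_trans _ n1).
have m1 : 1 <= m%:R :> R by rewrite ler1n.
have m0' : 0 < m%:R :> R by rewrite ltr0n.
have mN' : m%:R <= N%:R :> R by rewrite ler_nat.
have sm0 : 0 < Num.sqrt m%:R :> R by rewrite sqrtr_gt0.
have T10 : 0 <= T1 by rewrite divr_ge0 ?powR_ge0 ?sqrtr_ge0.
have KN0 : 0 <= KN by exact: powR_ge0.
have T20 : 0 <= T2 by rewrite mulr_ge0 ?addr_ge0 ?sqnorm_ge0.
(* The factor 2 leaves room for rounding: in the second case y >= 2 N^kappa >= 2, so its integer
   part l is at least y / 2 and at least N^kappa. *)
have [small|big] := ltP (Num.sqrt m%:R) (2 * N%:R `^ (kappa + zeta)).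
  apply: le_trans (iter_bound EP m x F_bound) _.
  have B1 : B <= 2 * B * T1.
    rewrite -mulrA mulrCA ler_peMr// /T1 mulrA ler_pdivlMr// mul1r.
    apply: le_trans (ltW small) _; rewrite ler_wpM2l//; exact: ler_powR.
  apply: le_trans B1 _; rewrite mulrDr -[leLHS]addr0; apply: lerD.
    by rewrite ler_wpM2r// -addrA lerDl !addr_ge0.
  by rewrite mulr_ge0// !addr_ge0// mulr_ge0.
pose y := Num.sqrt m%:R * N%:R `^ (- zeta).
pose l := Num.truncn y.
have Nz0 : 0 < N%:R `^ (- zeta) by exact: powR_gt0.
have y2 : 2 * N%:R `^ kappa <= y.
  rewrite /y -ler_pdivrMr// -powRN opprK -mulrA -powRD//.
  by rewrite (gt_eqF n0) implybT.
have Nk1 : 1 <= N%:R `^ kappa by have := ler_powR n1 k0; rewrite powRr0.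
have y0 : 0 <= y by lra.
have /andP[ly yl] := truncn_itv y0; rewrite -/l in ly yl.
rewrite -natr1 in yl.
have l2 : y / 2 <= l%:R by lra.
have l1 : 1 <= l%:R :> R by lra.
have l0 : (0 < l)%N by rewrite -(ler1n R).
have lN : N%:R `^ kappa <= l%:R by lra.
pose n := (m %/ k)%N.
have nk : (n * k <= m)%N by exact: leq_divM.
have g0 : 0 <= CA * l%:R `^ (- (2 * a)) by rewrite mulr_ge0 ?powR_ge0.
have BK0 : 0 <= B * KN by rewrite mulr_ge0.
have := avg_decay EP x (size_box l) C0 g0 BK0 smooth (@mem_box l) F_bound
  (fun z => box_avg_affine z n1 l0 kg lN) nk.
move=> /le_trans; apply.
have k1 : 0 < k%:R :> R by rewrite ltr0n.
have sk0 : 0 < Num.sqrt k%:R :> R by rewrite sqrtr_gt0.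
(* Cubes shorter than sqrt m by N^(- zeta) cost the factor N^(2 a zeta). In m^(1/2 - a), m is
   replaced by N if a <= 1/2, and the whole power by 1 otherwise; the two lower bounds on [theta]
   that involve [a] correspond to these cases. *)
have key : m%:R `^ (- a) * N%:R `^ (2 * a * zeta) <= T1.
  rewrite /T1 ler_pdivlMr// -powR12_sqrt ?ler0n// mulrAC -powRD ?(gt_eqF m0') ?implybT//.
  have [h|h] := leP 0 (- a + 2^-1).
    apply: (@le_trans _ _ (N%:R `^ (- a + 2^-1) * N%:R `^ (2 * a * zeta))).
      by rewrite ler_wpM2r ?powR_ge0// ge0_ler_powR ?nnegrE ?ler0n.
    rewrite -powRD ?(gt_eqF n0) ?implybT//; apply: ler_powR => //.
    by move: az1; lra.
  apply: (@le_trans _ _ (1 * N%:R `^ (2 * a * zeta))).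
    by rewrite ler_wpM2r ?powR_ge0//; have := ler_powR m1 (ltW h); rewrite powRr0.
  by rewrite mul1r ler_powR.
have T1Na : N%:R `^ (- a) <= T1.
  apply: le_trans key; apply: (@le_trans _ _ (m%:R `^ (- a) * 1)).
    rewrite mulr1 !powRN lef_pV2 ?posrE ?powR_gt0//.
    by rewrite ge0_ler_powR ?nnegrE ?ler0n.
  rewrite ler_wpM2l ?powR_ge0//; have := @ler_powR _ _ n1 0 (2 * a * zeta).
  by rewrite powRr0; apply; rewrite !mulr_ge0// ltW.
have first : (C * (d%:R * l%:R) / Num.sqrt n.+1%:R) ^+ k * B <= K1 * T1.
  apply: (@le_trans _ _ (K1 * N%:R `^ (- a))); last by rewrite ler_wpM2l.
  rewrite /K1 [leRHS]mulrAC ler_wpM2r//.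
  apply: (@le_trans _ _ ((C * d%:R * Num.sqrt k%:R * N%:R `^ (- zeta)) ^+ k)).
    rewrite lerXn2r ?nnegrE ?divr_ge0 ?mulr_ge0 ?sqrtr_ge0 ?powR_ge0//.
    rewrite ler_pdivrMr ?sqrtr_gt0 ?ltr0n// [leRHS](_ : _ =
      C * d%:R * (N%:R `^ (- zeta) * (Num.sqrt k%:R * Num.sqrt n.+1%:R))); last by ring.
    rewrite [leLHS]mulrA ler_wpM2l ?mulr_ge0//; apply: le_trans ly _.
    rewrite /y mulrC ler_wpM2l// -sqrtrM ?ler0n// -natrM ler_wsqrtr// ler_nat mulnC.
    exact/ltnW/ltn_ceil.
  rewrite exprMn ler_wpM2l ?exprn_ge0 ?mulr_ge0 ?sqrtr_ge0//.
  by rewrite -powR_mulrn ?powR_ge0// -powRrM ler_powR// mulNr lerN2 mulrC.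
have y0' : 0 < y by lra.
have second : 3 ^+ k * (CA * l%:R `^ (- (2 * a))) <= K2 * T1.
  rewrite /K2 -!mulrA ler_wpM2l ?exprn_ge0// ler_wpM2l//.
  apply: (@le_trans _ _ (4 `^ a * (m%:R `^ (- a) * N%:R `^ (2 * a * zeta)))); last first.
    by rewrite ler_wpM2l ?powR_ge0.
  have -> : 4 `^ a * (m%:R `^ (- a) * N%:R `^ (2 * a * zeta)) = (y / 2) `^ (- (2 * a)).
    rewrite powRM ?invr_ge0// mulrC; congr (_ * _).
      rewrite /y powRM ?sqrtr_ge0 ?powR_ge0// -powR12_sqrt ?ler0n// -!powRrM.
      by congr (_ `^ _ * _ `^ _); [field|ring].
    have e4 : (4 : R) = 2 `^ 2 by rewrite powR_mulrn// -natrX.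
    by rewrite -powR_inv1// e4 -!powRrM; congr (_ `^ _); ring.
  rewrite !powRN lef_pV2 ?posrE ?powR_gt0 ?divr_gt0 ?ltr0n//.
  by rewrite ge0_ler_powR ?nnegrE ?mulr_ge0 ?ler0n ?invr_ge0.
have lN2 : l%:R ^+ 2 <= N%:R :> R.
  apply: le_trans mN'; rewrite -[leRHS](@sqr_sqrtr R)// lerXn2r ?nnegrE ?sqrtr_ge0 ?ler0n//.
  apply: le_trans ly _; rewrite /y ler_piMr ?sqrtr_ge0//.
  by have := @ler_powR _ _ n1 (- zeta) 0; rewrite powRr0; apply; rewrite oppr_le0 ltW.
have third : 3 ^+ k * (2 * (B * KN) * (d%:R * l%:R ^+ 2) + B * KN * (sqnorm x + m%:R * E sqnorm))
   <= K3 * T2.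
  rewrite /K3 /T2 -!mulrA ler_wpM2l ?exprn_ge0//.
  rewrite [leLHS](_ : _ = B * (KN * (2 * (d%:R * l%:R ^+ 2) + (sqnorm x + m%:R * E sqnorm)))); last by ring.
  rewrite [X in _ <= _ * X]mulrCA ler_wpM2l// ler_wpM2l//.
  have h1 := ler_wpM2l (ler0n R d) lN2.
  have h2 := ler_wpM2r s20 mN'.
  have h3 : 0 <= d%:R * sqnorm x :> R by rewrite mulr_ge0 ?sqnorm_ge0.
  have h4 : 0 <= E sqnorm * sqnorm x :> R by rewrite mulr_ge0 ?sqnorm_ge0.
  rewrite !mulrDr !mulrDl; lra.
apply: (@le_trans _ _ (K1 * T1 + (K2 * T1 + K3 * T2))).
  apply: le_trans (lerD first (lerD second third)).
  by rewrite le_eqVlt; apply/orP; left; apply/eqP; ring.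
rewrite [leRHS]mulrDr.
have := mulr_ge0 B0 T10; have := mulr_ge0 B0 T20; have := mulr_ge0 K10 T20.
have := mulr_ge0 K20 T20; have := mulr_ge0 K30 T10.
rewrite !mulrDl -!mulrA; lra.
Qed.

End Decay.

(** * The corrector and the martingale decomposition *)

Definition harmonic_sum (R : realType) (n : nat) : R := \sum_(i < n) i.+1%:R^-1.

Lemma sum_inv_sqrt (R : realType) n :
  \sum_(i < n) (Num.sqrt i.+1%:R)^-1 <= 2 * Num.sqrt n%:R :> R.
Proof.
elim: n => [|n IH]; first by rewrite big_ord0 sqrtr0 mulr0.
rewrite big_ord_recr /=; apply: le_trans (lerD IH (lexx _)) _.
set q := Num.sqrt n%:R; set p := Num.sqrt n.+1%:R.
have p0 : 0 < p by rewrite sqrtr_gt0 ltr0n.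
have q0 : 0 <= q by rewrite sqrtr_ge0.
have e : p ^+ 2 = q ^+ 2 + 1 by rewrite !sqr_sqrtr// natr1.
rewrite -lerBrDl -div1r ler_pdivrMr//.
rewrite !expr2 in e; nra.
Qed.

Section Corrector.
Context {R : realType} {d : nat}.
Local Notation V := 'rV[int]_d.
Implicit Types (x z v : V).

Variables (E : (V -> R) -> R) (C : R) (F : V -> R) (B K : R).
Variables (N : nat) (Theta kN : R).
Hypotheses (EP : step_law E) (C0 : 0 <= C) (K0 : 0 <= K)
  (smooth : forall v, smoothing E v (C * l1norm v))
  (F_bound : forall z, `|F z| <= B)
  (N0 : (0 < N)%N) (Theta1 : 1 <= Theta) (kN0 : 0 <= kN)
  (decay : forall m x, (0 < m <= N)%N -> `|iter m (step_op E) F x| <=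
     K * (Theta / Num.sqrt m%:R + kN * (sqnorm x + N%:R))).

Local Notation Q := (step_op E).

Let B0 : 0 <= B. Proof. exact: le_trans (normr_ge0 _) (F_bound 0). Qed.
Let Theta0 : 0 <= Theta. Proof. exact: le_trans Theta1. Qed.
Let E0 : 0 <= E sqnorm.
Proof. by apply: (step_ge0 EP); [exact: grows_sqnorm|exact: sqnorm_ge0]. Qed.
Let F_grows : grows F. Proof. exact: bounded_grows F_bound. Qed.

(* Solves the Poisson equation [F = u - Q u] up to the error [Q^N F]. *)
Definition corrector x : R := \sum_(m < N) iter m Q F x.

(** The summands are the constants of the estimates [t1], [t2], [t3] in the next proof. *)
Let Kd := 2 * C * K + C * K + K * (3 + 2 * E sqnorm).

(** About half of the m steps provide the decay Theta / sqrt m and the other half smooth the result,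
    gaining another 1 / sqrt m. *)
Lemma iter_increment m x v : (0 < m <= N)%N ->
  `|iter m Q F (x + v) - iter m Q F x| <=
    Kd * ((1 + sqnorm v) * (Theta / m%:R + kN * (sqnorm x + N%:R))).
Proof.
move=> /andP[m0 mN]; pose n1 := (m %/ 2)%N; pose n2 := (m - n1)%N.
have n1m : (n1 <= m)%N by exact: leq_div.
have n20 : (0 < n2)%N by rewrite subn_gt0 ltn_Pdiv.
have n2N : (0 < n2 <= N)%N by rewrite n20 (leq_trans _ mN)// leq_subr.
have iE z : iter m Q F z = iter n1 Q (iter n2 Q F) z by rewrite -iterD subnKC.
rewrite !iE.
set g := K * (Theta / Num.sqrt n2%:R + kN * N%:R).
have s20 : 0 < Num.sqrt n2%:R :> R by rewrite sqrtr_gt0 ltr0n.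
have g0 : 0 <= g by rewrite mulr_ge0// addr_ge0// ?divr_ge0 ?mulr_ge0// ltW.
have KkN : 0 <= K * kN by rewrite mulr_ge0.
have hG z : `|iter n2 Q F z| <= g + (K * kN) * sqnorm z.
  apply: le_trans (decay z n2N) _; rewrite /g le_eqVlt; apply/orP; left; apply/eqP; ring.
apply: le_trans (smoothing_affine EP n1 x g0 KkN (smooth v) hG) _.
have sv := sqnorm_ge0 (R := R) v; have sx := sqnorm_ge0 (R := R) x.
have lv := l1norm_le_sqnorm (R := R) v; have lv0 := l1norm_ge0 (R := R) v.
have s1 : 1 <= Num.sqrt n1.+1%:R :> R by rewrite -[leLHS]sqrtr1 ler_wsqrtr// ler1n.
have s10 : 0 < Num.sqrt n1.+1%:R :> R by rewrite (lt_le_trans _ s1).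
have m0' : 0 < m%:R :> R by rewrite ltr0n.
have prod : m%:R / 2 <= Num.sqrt n2%:R * Num.sqrt n1.+1%:R :> R.
  have a1 : m%:R / 2 <= n2%:R :> R.
    by rewrite ler_pdivrMr// -natrM ler_nat mulnBl muln2 -addnn -addnBA ?leq_divM// leq_addr.
  have a2 : m%:R / 2 <= n1.+1%:R :> R.
    by rewrite ler_pdivrMr// -natrM ler_nat; exact/ltnW/ltn_ceil.
  by rewrite -[leLHS](@sqr_sqrtr R) ?divr_ge0// expr2 ler_pM ?sqrtr_ge0// ler_wsqrtr.
have t1 : C * l1norm v * (K * (Theta / Num.sqrt n2%:R)) / Num.sqrt n1.+1%:R <=
    2 * C * K * (1 + sqnorm v) * (Theta / m%:R).
  rewrite [leLHS](_ : _ = C * K * Theta * (l1norm v * (Num.sqrt n2%:R * Num.sqrt n1.+1%:R)^-1));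
    last by field; rewrite !gt_eqF.
  rewrite [leRHS](_ : _ = C * K * Theta * ((1 + sqnorm v) * (m%:R / 2)^-1));
    last by field; rewrite gt_eqF.
  rewrite ler_wpM2l ?mulr_ge0// ler_pM// ?invr_ge0 ?mulr_ge0 ?sqrtr_ge0//.
    by lra.
  by rewrite lef_pV2// posrE ?mulr_gt0 ?divr_gt0.
have t2 : C * l1norm v * (K * (kN * N%:R)) / Num.sqrt n1.+1%:R <=
    C * K * (1 + sqnorm v) * (kN * N%:R).
  rewrite ler_pdivrMr// [leLHS](_ : _ = C * K * (kN * N%:R) * l1norm v); last by ring.
  rewrite [leRHS](_ : _ = C * K * (kN * N%:R) * ((1 + sqnorm v) * Num.sqrt n1.+1%:R)); last by ring.
  rewrite ler_wpM2l ?mulr_ge0//; apply: le_trans lv _.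
  apply: (@le_trans _ _ (1 + sqnorm v)); first by lra.
  by rewrite ler_peMr ?addr_ge0.
have t3 : K * kN * (sqnorm (x + v) + sqnorm x + 2 * n1%:R * E sqnorm) <=
    K * (3 + 2 * E sqnorm) * ((1 + sqnorm v) * (kN * (sqnorm x + N%:R))).
  rewrite [leRHS](_ : _ = K * kN * ((3 + 2 * E sqnorm) * ((1 + sqnorm v) * (sqnorm x + N%:R))));
    last by ring.
  rewrite ler_wpM2l//.
  have h := sqnormD (R := R) x v.
  have N1 : 1 <= N%:R :> R by rewrite ler1n.
  have nN : n1%:R <= N%:R :> R by rewrite ler_nat (leq_trans n1m).
  pose W : R := (1 + sqnorm v) * (sqnorm x + N%:R).
  have W1 : sqnorm x + N%:R + sqnorm v <= W.
    by rewrite /W mulrDl mul1r lerD2l ler_peMr//; lra.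
  have p1 : n1%:R * E sqnorm <= N%:R * E sqnorm by rewrite ler_wpM2r.
  have p2 : N%:R * E sqnorm <= W * E sqnorm by rewrite ler_wpM2r//; lra.
  rewrite -/W [leRHS](_ : _ = 3 * W + 2 * (W * E sqnorm)); last by ring.
  rewrite -[2 * n1%:R * _]mulrA; lra.
set k1 := Theta / m%:R in t1 *; have k10 : 0 <= k1 by rewrite divr_ge0.
set k2 := kN * (sqnorm x + N%:R) in t3 *.
have k20 : 0 <= k2 by rewrite mulr_ge0// addr_ge0.
have k23 : kN * N%:R <= k2 by rewrite /k2 ler_wpM2l// lerDr.
rewrite [leLHS](_ : _ = C * l1norm v * (K * (Theta / Num.sqrt n2%:R)) / Num.sqrt n1.+1%:R +
  (C * l1norm v * (K * (kN * N%:R)) / Num.sqrt n1.+1%:R +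
  K * kN * (sqnorm (x + v) + sqnorm x + 2 * n1%:R * E sqnorm))); last by rewrite /g; ring.
apply: le_trans (lerD t1 (lerD t2 t3)) _.
have v1 : 0 <= 1 + sqnorm v :> R by rewrite addr_ge0.
have CK := mulr_ge0 C0 K0.
have e1 : C * K * (1 + sqnorm v) * (kN * N%:R) <= C * K * (1 + sqnorm v) * k2.
  by rewrite ler_wpM2l// mulr_ge0.
apply: le_trans (lerD (lexx _) (lerD e1 (lexx _))) _.
rewrite -subr_ge0 [leRHS](_ : _ = 2 * (C * K * (1 + sqnorm v) * k2) +
  (C * K * (1 + sqnorm v) * k1 + K * (3 + 2 * E sqnorm) * (1 + sqnorm v) * k1));
  last by rewrite /Kd; ring.
by rewrite !addr_ge0// !mulr_ge0// addr_ge0// mulr_ge0.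
Qed.

Lemma corrector_increment x v :
  `|corrector (x + v) - corrector x| <= (2 * B + Kd) * (1 + sqnorm v) *
    (1 + Theta * harmonic_sum R N + N%:R * kN * (sqnorm x + N%:R)).
Proof.
have sv := sqnorm_ge0 (R := R) v; have sx := sqnorm_ge0 (R := R) x.
have Kd0 : 0 <= Kd by rewrite !addr_ge0 ?mulr_ge0 ?addr_ge0 ?mulr_ge0.
set w := kN * (sqnorm x + N%:R); have w0 : 0 <= w by rewrite mulr_ge0// addr_ge0.
rewrite -mulrA -/w /corrector -sumrB; apply: le_trans (ler_norm_sum _ _ _) _.
(* The term m = 0 is F itself, without decay: it is bounded by 2 B, and the default value 0^-1 = 0
   removes Theta / m there. *)
have each (m : 'I_N) : `|iter m Q F (x + v) - iter m Q F x| <=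
    (m == 0%N :> nat)%:R * (2 * B) + Kd * (1 + sqnorm v) * (Theta * (m : nat)%:R^-1 + w).
  case: eqP => [->|/eqP m0] /=.
    rewrite mul1r invr0 mulr0 add0r -[leLHS]addr0; apply: lerD.
      rewrite mulr_natl mulr2n; exact: le_trans (ler_normB _ _) (lerD _ _).
    by rewrite !mulr_ge0// addr_ge0.
  rewrite mul0r add0r -mulrA; apply: iter_increment.
  by rewrite lt0n m0 ltnW.
apply: le_trans (ler_sum _ (fun m _ => each m)) _.
rewrite big_split /= -mulr_suml -mulr_sumr big_split /= -mulr_sumr.
rewrite (_ : \sum_(m < N) _ = 1); last first.
  by rewrite -(prednK N0) big_ord_recl /= big1 ?addr0.
have h : \sum_(m < N) (m : nat)%:R^-1 <= harmonic_sum R N :> R.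
  case: (N) => [|n]; first by rewrite /harmonic_sum !big_ord0.
  by rewrite /harmonic_sum big_ord_recl big_ord_recr /= invr0 add0r lerDl invr_ge0.
have h0 : 0 <= harmonic_sum R N by apply: sumr_ge0 => i _; rewrite invr_ge0.
rewrite sumr_const card_ord -[w *+ N]mulr_natl mul1r.
have v1 : 0 <= 1 + sqnorm v :> R by rewrite addr_ge0.
set S := \sum_(m < N) _ in h *.
have a1 : Kd * (1 + sqnorm v) * (Theta * S + N%:R * w) <=
  Kd * (1 + sqnorm v) * (1 + Theta * harmonic_sum R N + N%:R * w).
  rewrite ler_wpM2l ?mulr_ge0// lerD2r.
  by have := ler_wpM2l Theta0 h; lra.
have a2 : 2 * B <= 2 * B * (1 + sqnorm v) * (1 + Theta * harmonic_sum R N + N%:R * w).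
  rewrite -[leLHS]mulr1 -[leRHS]mulrA ler_wpM2l ?mulr_ge0//.
  rewrite -[leLHS]mulr1 ler_pM//; first by lra.
  by rewrite -addrA lerDl !addr_ge0 ?mulr_ge0// addr_ge0.
apply: le_trans (lerD a2 a1) _.
rewrite le_eqVlt; apply/orP; left; apply/eqP; rewrite /w; ring.
Qed.

Lemma op_corrector x : Q corrector x = \sum_(m < N) iter m.+1 Q F x.
Proof.
have := iter_sum EP (index_enum 'I_N) 1 (f := fun (m : 'I_N) => iter m Q F) x.
by apply => m; exact: iter_grows.
Qed.

Lemma correctorE x : F x = corrector x - Q corrector x + iter N Q F x.
Proof.
rewrite op_corrector /corrector -sumrB.
have := @telescope_sumr R 0 N (fun m => - iter m Q F x) (leq0n _).
rewrite big_mkord => e.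
rewrite (eq_bigr (fun m : 'I_N => - iter m.+1 Q F x - - iter m Q F x)).
  by rewrite e /= opprK; ring.
by move=> m _; rewrite opprK addrC.
Qed.

(** Unlike the corrector, its image under Q has no term m = 0, so the decay applies to every
    summand. This is why the boundary terms of the decomposition are values of [Q corrector]. *)
Lemma op_corrector_bound x :
  `|Q corrector x| <= K * (2 * Theta * Num.sqrt N%:R + N%:R * kN * (sqnorm x + N%:R)).
Proof.
rewrite op_corrector; apply: le_trans (ler_norm_sum _ _ _) _.
have each (m : 'I_N) : `|iter m.+1 Q F x| <=
    K * (Theta * (Num.sqrt m.+1%:R)^-1 + kN * (sqnorm x + N%:R)) by apply: decay; exact: ltn_ord.
apply: le_trans (ler_sum _ (fun m _ => each m)) _.
rewrite -mulr_sumr ler_wpM2l// big_split /= -mulr_sumr sumr_const card_ord.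
rewrite -[_ *+ N]mulr_natl mulrA lerD2r [2 * Theta]mulrC -mulrA.
by rewrite ler_wpM2l// sum_inv_sqrt.
Qed.

Lemma corrector_bound x : `|corrector x| <= N%:R * B.
Proof.
apply: le_trans (ler_norm_sum _ _ _) _.
apply: le_trans (ler_sum _ (fun (m : 'I_N) _ => iter_bound EP m x F_bound)) _.
by rewrite sumr_const card_ord mulr_natl.
Qed.

Lemma corrector_mean0 x : E (fun v => corrector (x + v) - Q corrector x) = 0.
Proof.
rewrite (stepB EP) ?(step_cst EP) ?subrr//; last exact: grows_cst.
by apply: (bounded_grows (B := N%:R * B)) => v; exact: corrector_bound.
Qed.

(** The variance is at most the second moment about any point; taking the point [corrector x] makes
    increments of the corrector appear. *)
Lemma corrector_variance x :
  E (fun v => (corrector (x + v) - Q corrector x) ^+ 2) <=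
  ((2 * B + Kd) * (1 + Theta * harmonic_sum R N + N%:R * kN * (sqnorm x + N%:R))) ^+ 2 *
    E (fun v => (1 + sqnorm v) ^+ 2).
Proof.
have gv : grows (fun v => corrector (x + v)).
  by apply: (bounded_grows (B := N%:R * B)) => v; exact: corrector_bound.
have gv2 c : grows (fun v => (corrector (x + v) - c) ^+ 2).
  apply: (bounded_grows (B := (N%:R * B + `|c|) ^+ 2)) => v.
  rewrite normrX lerXn2r ?nnegrE ?addr_ge0 ?mulr_ge0//.
  exact: le_trans (ler_normB _ _) (lerD (corrector_bound _) _).
apply: (@le_trans _ _ (E (fun v => (corrector (x + v) - corrector x) ^+ 2))).
  set q := Q corrector x; set p := corrector x.
  rewrite [X in _ <= E X](_ : _ = fun v => (corrector (x + v) - q) ^+ 2 +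
    ((2 * (q - p)) * (corrector (x + v) - q) + (q - p) ^+ 2)); last first.
    by apply/funext => v; ring.
  have gq : grows (fun v => corrector (x + v) - q) by exact/growsB/grows_cst.
  rewrite (stepD EP)//; last by apply: growsD; [exact: growsZ|exact: grows_cst].
  rewrite (step_lin EP)//; last exact: grows_cst.
  by rewrite corrector_mean0 mulr0 add0r (step_cst EP) lerDl sqr_ge0.
rewrite -(stepZ EP); last exact: grows_sqnorm2.
apply: (step_le EP) => //; first exact/growsZ/grows_sqnorm2.
move=> v; rewrite -exprMn -[leLHS]real_normK ?num_real// mulrAC.
have inc := corrector_increment x v.
by rewrite lerXn2r ?nnegrE// (le_trans (normr_ge0 _) inc).
Qed.

(** A deterministic statement about any path: chance enters only through the bound [lam] on the
    martingale. The coefficient 5 is 2 + 2 for the two boundary terms and 1 for the sum of the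
    errors Q^N F; likewise 3 = 1 + 1 + 1. *)
Lemma path_sum_bound (s : nat -> V) (r lam : R) n : (n <= N)%N ->
  (forall i, (i <= n)%N -> sqnorm (s i) <= r) ->
  `|\sum_(i < n) (corrector (s i.+1) - Q corrector (s i))| <= lam ->
  `|\sum_(1 <= i < n.+1) F (s i)| <= lam + K * (5 * Theta * Num.sqrt N%:R +
     3 * (N%:R * kN * (r + N%:R))).
Proof.
move=> nN sr hlam.
have N0' : 0 < N%:R :> R by rewrite ltr0n.
have sN0 : 0 < Num.sqrt N%:R :> R by rewrite sqrtr_gt0.
have r0 : 0 <= r by exact: le_trans (sqnorm_ge0 _) (sr 0%N _).
have Q_le i : (i <= n)%N -> `|Q corrector (s i)| <=
    K * (2 * Theta * Num.sqrt N%:R + N%:R * kN * (r + N%:R)).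
  move=> /sr sir; apply: le_trans (op_corrector_bound _) _.
  by rewrite ler_wpM2l// lerD2l ler_wpM2l ?mulr_ge0// lerD2r.
have last_le : `|\sum_(i < n) iter N Q F (s i.+1)| <=
    K * (Theta * Num.sqrt N%:R + N%:R * kN * (r + N%:R)).
  apply: le_trans (ler_norm_sum _ _ _) _.
  apply: (@le_trans _ _ (\sum_(i < n) K * (Theta / Num.sqrt N%:R + kN * (r + N%:R)))).
    apply: ler_sum => i _; apply: le_trans (decay _ _) _; first by rewrite N0 leqnn.
    by rewrite ler_wpM2l// lerD2l ler_wpM2l// lerD2r sr.
  rewrite sumr_const card_ord -[_ *+ n]mulr_natl mulrCA ler_wpM2l//.
  set t := _ + _; have t0 : 0 <= t by rewrite addr_ge0 ?divr_ge0 ?mulr_ge0 ?addr_ge0// ltW.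
  apply: (@le_trans _ _ (N%:R * t)); first by rewrite ler_wpM2r// ler_nat.
  rewrite /t mulrDr !mulrA lerD2r -[X in X * Theta](@sqr_sqrtr R)//.
  rewrite le_eqVlt; apply/orP; left; apply/eqP; field; exact: lt0r_neq0.
have e : \sum_(1 <= i < n.+1) F (s i) =
    (\sum_(i < n) (corrector (s i.+1) - Q corrector (s i))) +
    (Q corrector (s 0%N) - Q corrector (s n)) + \sum_(i < n) iter N Q F (s i.+1).
  rewrite big_add1 /= big_mkord.
  elim: n {nN sr hlam Q_le last_le} => [|n IH]; first by rewrite !big_ord0; ring.
  by rewrite !big_ord_recr /= IH [F (s n.+1)]correctorE; ring.
rewrite e; apply: le_trans (ler_normD _ _) _.
apply: le_trans (lerD (ler_normD _ _) last_le) _.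
apply: le_trans (lerD (lerD hlam (ler_normB _ _)) (lexx _)) _.
apply: le_trans (lerD (lerD (lexx _) (lerD (Q_le _ _) (Q_le _ _))) (lexx _)) _ => //.
rewrite le_eqVlt; apply/orP; left; apply/eqP; ring.
Qed.

End Corrector.

(** * Discrete random variables *)

Section DiscreteVariables.
Context {disp : measure_display} {T : measurableType disp} {R : realType}.
Variable P : probability T R.

Definition discrete {I : Type} (Y : T -> I) : Prop :=
  forall A : set I, measurable (Y @^-1` A).

Definition fiber {I : countType} (Y : T -> I) (k : nat) : set T :=
  [set w | choice.pickle (Y w) = k].

Lemma fiber_measurable {I : countType} (Y : T -> I) k : discrete Y -> measurable (fiber Y k).
Proof. by move=> dY; exact: (dY [set i | choice.pickle i = k]). Qed.

Lemma fiber_cover {I : countType} (Y : T -> I) : \bigcup_k fiber Y k = setT.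
Proof. by apply/seteqP; split => // w _; exists (choice.pickle (Y w)). Qed.

Lemma fiber_trivIset {I : countType} (Y : T -> I) : trivIset setT (fiber Y).
Proof. by move=> i j _ _ [w [<- <-]]. Qed.

Lemma fiber_eq {I : countType} (Y : T -> I) k w w0 : fiber Y k w -> fiber Y k w0 ->
  Y w = Y w0.
Proof. by move=> e; rewrite /fiber/= -e => /(pcan_inj choice.pickleK). Qed.

Lemma discrete_measurable {I : Type} (Y : T -> I) d' (U : measurableType d') (f : I -> U) D :
  discrete Y -> measurable D -> measurable_fun D (fun w => f (Y w)).
Proof. by move=> dY mD _ A mA; apply: measurableI => //; exact: (dY (f @^-1` A)). Qed.

Lemma discrete_bind {I : countType} (J : Type) (Y : T -> I) (f : I -> T -> J) :
  discrete Y -> (forall i, discrete (f i)) -> discrete (fun w => f (Y w) w).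
Proof.
move=> dY df A; rewrite (_ : _ @^-1` A = \bigcup_k (fiber Y k `&`
   (if choice.unpickle k is Some i then f i @^-1` A else set0))).
  apply: bigcupT_measurable => k; apply: measurableI; first exact: fiber_measurable.
  by case: choice.unpickle => // i; exact: df.
apply/seteqP; split => w /=; first by move=> h; exists (choice.pickle (Y w)) => //; rewrite choice.pickleK.
by move=> [k _ [<-]]; rewrite choice.pickleK.
Qed.

Lemma integral_fibers {I : countType} (Y : T -> I) (A : set T) (f : T -> \bar R) :
  discrete Y -> measurable A -> measurable_fun A f -> (forall w, 0 <= f w)%E ->
  (\int[P]_(w in A) f w = \sum_(k <oo) \int[P]_(w in A `&` fiber Y k) f w)%E.
Proof.
move=> dY mA mf f0; rewrite -ge0_integral_bigcup -?setI_bigcupr ?fiber_cover ?setIT//.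
- by move=> k; apply: measurableI => //; exact: fiber_measurable.
- by apply: trivIset_setIl; exact: fiber_trivIset.
Qed.

(** On each fiber the integrand is constant, so the claim reduces, term by term, to the product
    formula for probabilities. *)
Lemma integral_indep {I : countType} (Y Y' : T -> I) (A : set T) (g : I -> \bar R) :
  discrete Y -> discrete Y' -> measurable A -> (forall i, 0 <= g i)%E ->
  (forall B, P (A `&` Y @^-1` B) = P A * P (Y' @^-1` B))%E ->
  (\int[P]_(w in A) g (Y w) = P A * \int[P]_w g (Y' w))%E.
Proof.
move=> dY dY' mA g0 ind.
rewrite (integral_fibers dY)//; last exact: discrete_measurable.
rewrite (integral_fibers dY')//; last exact: discrete_measurable.
have Afin : P A = (fine (P A))%:E by rewrite fineK// fin_num_measure.
rewrite Afin -nneseriesZl; last by move=> k _; exact: integral_ge0.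
apply: eq_eseriesr => k _; rewrite -Afin setTI.
have const (Z : T -> I) i (D : set T) : choice.pickle i = k -> measurable D ->
    D `<=` fiber Z k -> (\int[P]_(w in D) g (Z w) = g i * P D)%E.
  move=> ik mD DZ; rewrite -integral_cst//; apply: eq_integral => w.
  by rewrite inE => /DZ; rewrite /fiber /= -ik => /(pcan_inj choice.pickleK) ->.
have mk Z : discrete Z -> measurable (fiber Z k) by exact: fiber_measurable.
have [[i ik]|no] := pselect (exists i : I, choice.pickle i = k).
  rewrite (const Y i)//; last by apply: measurableI => //; exact: mk.
  rewrite (const Y' i)//; last exact: mk.
  by rewrite (ind [set i | choice.pickle i = k]) muleCA.
have none (Z : T -> I) : fiber Z k = set0.
  by apply/seteqP; split => // w zk; apply: no; exists (Z w).
by rewrite !none setI0 !integral_set0 mule0.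
Qed.

End DiscreteVariables.

(** * Independence of the next step from the past *)

Section History.
Context {disp : measure_display} {T : measurableType disp} {R : realType} {d : nat}.
Variables (P : probability T R) (X : nat -> T -> 'rV[int]_d).
Hypothesis X_iid : iid_steps P X.
Local Notation V := 'rV[int]_d.

Let X_disc n : discrete (X n). Proof. by have [h _ _] := X_iid; exact: h. Qed.

(** The past takes values in a countable type, so conditioning on it is a sum over its values and
    replaces filtrations and conditional expectations. *)
Definition history (n : nat) (w : T) : seq V := [seq X i w | i <- iota 0 n].

Lemma historyS n w : history n.+1 w = rcons (history n w) (X n w).
Proof.
rewrite /history; have -> : iota 0 n.+1 = rcons (iota 0 n) n.
  by rewrite -addn1 iotaD cats1.
exact: map_rcons.
Qed.

Lemma history_discrete n : discrete (history n).
Proof.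
elim: n => [|n IH].
  move=> A; rewrite (_ : _ @^-1` A = if `[< A [::] >] then setT else set0).
    by case: ifP.
  by apply/seteqP; split => w; case: asboolP.
have -> : history n.+1 = fun w => (fun h w => rcons h (X n w)) (history n w) w.
  by apply/funext => w; exact: historyS.
apply: (@discrete_bind _ _ _ _ (history n) (fun h w => rcons h (X n w))) => // h A.
exact: (X_disc n (fun v => A (rcons h v))).
Qed.

Lemma history_indep n (h : seq V) (B : set V) : size h = n ->
  (P ((history n @^-1` [set h]) `&` X n @^-1` B) =
   P (history n @^-1` [set h]) * P (X 0%N @^-1` B))%E.
Proof.
move=> sh; have [_ ind idd] := X_iid.
pose I := [fset i | i in iota 0 n]%fset.
(* One family serves both cylinders: the coordinates below n are pinned to [h], and coordinate n
   lies in [B]. *)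
pose A i : set V := if i == n then B else [set nth 0 h i].
have memI i : (i \in I) = (i < n)%N.
  by rewrite /I; apply/imfsetP/idP => [[j /=]|ilt]; [rewrite mem_iota => ? ->|
    exists i => //=; rewrite mem_iota].
have nI : n \notin I by rewrite memI ltnn.
have hE : history n @^-1` [set h] = \bigcap_(i in [set` I]) (X i @^-1` A i).
  apply/seteqP; split => w /=.
    move=> hw i /=; rewrite memI => ilt; rewrite /A /= ltn_eqF//= -hw.
    by rewrite (nth_map 0%N) ?size_iota// nth_iota.
  move=> hw; apply: (@eq_from_nth _ 0); rewrite size_map size_iota// => i ilt.
  rewrite (nth_map 0%N) ?size_iota// nth_iota//.
  by have := hw i; rewrite /A /= memI => /(_ ilt); rewrite ltn_eqF.
have hE' : history n @^-1` [set h] `&` X n @^-1` B =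
    \bigcap_(i in [set` (n |` I)%fset]) (X i @^-1` A i).
  rewrite hE; apply/seteqP; split => w /=.
    move=> [hI hB] i /=; rewrite in_fset1U => /orP[/eqP ->|]; last exact: hI.
    by rewrite /A eqxx.
  move=> hw; split; last by have := hw n; rewrite /= fset1U1 /A eqxx; exact.
  by move=> i /= iI; apply: hw; rewrite /= in_fset1U iI orbT.
rewrite hE' hE !ind big_fsetU1//= muleC; congr (_ * _)%E.
by rewrite /A eqxx; exact: idd.
Qed.

(* The last step is independent of the past, and distributed as the first one. *)
Lemma integral_history n (g : seq V -> V -> \bar R) : (forall h v, 0 <= g h v)%E ->
  (\int[P]_w g (history n w) (X n w) =
   \int[P]_w \int[P]_w' g (history n w) (X 0%N w'))%E.
Proof.
move=> g0.
rewrite (integral_fibers P (@history_discrete n) measurableT); last 2 first.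
- apply: (@discrete_measurable _ _ _ (fun w => (history n w, X n w)) _ _
    (fun hv => g hv.1 hv.2)) => //.
  apply: (@discrete_bind _ _ _ _ (history n) (fun h w => (h, X n w))).
    exact: history_discrete.
  by move=> h A; exact: (X_disc n (fun v => A (h, v))).
- by [].
rewrite (integral_fibers P (@history_discrete n) measurableT); last 2 first.
- apply: (@discrete_measurable _ _ _ (history n) _ _
    (fun h => \int[P]_w' g h (X 0%N w'))%E) => //; exact: history_discrete.
- by move=> w; exact: integral_ge0.
apply: eq_eseriesr => k _; rewrite setTI.
have [->|/set0P[w0 hw0]] := eqVneq (fiber (history n) k) set0.
  by rewrite !integral_set0.
set h := history n w0; have fE : fiber (history n) k = history n @^-1` [set h].
  apply/seteqP; split => w /=; first by move=> hw; exact: fiber_eq hw hw0.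
  by rewrite /fiber /= => ->.
have mF := fiber_measurable k (@history_discrete n).
transitivity (\int[P]_(w in fiber (history n) k) g h (X n w))%E.
  by apply: eq_integral => w; rewrite inE => hw; rewrite (fiber_eq hw hw0).
transitivity (\int[P]_(w in fiber (history n) k) cst (\int[P]_w' g h (X 0%N w')) w)%E; last first.
  by apply: eq_integral => w; rewrite inE => hw; rewrite (fiber_eq hw hw0).
rewrite integral_cst// muleC; apply: (@integral_indep _ _ _ P _ (X n) (X 0%N) _ (g h)) => //.
move=> B; rewrite fE; apply: history_indep.
by rewrite size_map size_iota.
Qed.

End History.

(** * Expectation over one step *)

Section WalkExpectation.
Context {disp : measure_display} {T : measurableType disp} {R : realType} {d : nat}.
Variables (P : probability T R) (X : nat -> T -> 'rV[int]_d).
Hypotheses (X_iid : iid_steps P X)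
  (X_centered : forall j : 'I_d, ('E_P[fun w => ((X 0%N w) ord0 j)%:~R] = 0)%E)
  (X_moments : forall k : nat, ('E_P[fun w => (enorm R (X 0%N w) ^+ k)%R] < +oo)%E).
Local Notation V := 'rV[int]_d.

Let X_disc n : discrete (X n). Proof. by have [h _ _] := X_iid; exact: h. Qed.

Definition step_mean (f : V -> R) : R := \int[P]_w f (X 0%N w).

Lemma sqnorm2_integrable :
  P.-integrable setT (fun w => ((1 + sqnorm (X 0%N w)) ^+ 2)%:E).
Proof.
have m4 : P.-integrable setT (fun w => (enorm R (X 0%N w) ^+ 4)%:E).
  apply/integrableP; split.
    exact: (discrete_measurable (fun v : V => (enorm R v ^+ 4)%:E) (X_disc 0)).
  have := X_moments 4; rewrite unlock; apply: le_lt_trans.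
  rewrite le_eqVlt; apply/orP; left; apply/eqP; apply: eq_integral => w _.
  by rewrite gee0_abs// lee_fin exprn_ge0// sqrtr_ge0.
have c2 : P.-integrable setT (EFin \o cst 2) by exact: finite_measure_integrable_cst.
apply: le_integrable (integrableD measurableT c2 (integrableZl measurableT 2 m4)) => //.
  exact: (discrete_measurable (fun v : V => ((1 + sqnorm v) ^+ 2)%:E) (X_disc 0)).
move=> w _; rewrite -EFinM -EFinD !abse_EFin lee_fin.
rewrite (_ : 4 = 2 * 2)%N// exprM enormE !ger0_norm ?sqr_ge0//; last first.
  by rewrite addr_ge0// mulr_ge0// sqr_ge0.
by have := sqr_ge0 (1 - sqnorm (R := R) (X 0%N w)); rewrite /=; lra.
Qed.

Lemma grows_integrable f : grows f -> P.-integrable setT (fun w => (f (X 0%N w))%:E).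
Proof.
move=> [C hC]; apply: le_integrable (integrableZl measurableT C sqnorm2_integrable) => //.
  exact: (discrete_measurable (fun v : V => (f v)%:E) (X_disc 0)).
move=> w _; rewrite -EFinM !abse_EFin lee_fin; apply: le_trans (hC _) _; exact: ler_norm.
Qed.

Lemma step_meanE f : grows f -> (\int[P]_w (f (X 0%N w))%:E = (step_mean f)%:E)%E.
Proof.
move=> hf; rewrite fineK//; apply: integrable_fin_num => //; exact: grows_integrable.
Qed.

Lemma step_mean_law : step_law step_mean.
Proof.
split.
- move=> a f g hf hg; rewrite /step_mean RintegralD//.
  + by rewrite RintegralZl//; exact: grows_integrable.
  + exact: grows_integrable (growsZ a hf).
  + exact: grows_integrable.
- by move=> f g hf hg fg; apply: le_Rintegral => //; exact: grows_integrable.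
- move=> c; rewrite /step_mean Rintegral_cst// -[RHS]mulr1; congr (_ * _).
  exact: (congr1 fine (probability_setT P)).
- by move=> j; rewrite /step_mean /Rintegral; have := X_centered j; rewrite unlock => ->.
Qed.

Lemma step_mass_gt0 v : law_support P (X 0%N) v -> step_mass step_mean v != 0.
Proof.
move=> hv; rewrite /step_mass /step_mean.
rewrite (_ : \int[P]_w _ = fine (P (X 0%N @^-1` [set v]))).
  by rewrite gt_eqF// fine_gt0// hv -ge0_fin_numE// fin_num_measure//; exact: X_disc.
have -> : P (X 0%N @^-1` [set v]) = (\int[P]_w (\1_(X 0%N @^-1` [set v]) w)%:E)%E.
  by rewrite integral_indic ?setIT//; exact: X_disc.
congr fine; apply: eq_integral => w _; rewrite indicE; congr (_%:R%:E).
by case: eqP => h; [rewrite mem_set|rewrite memNset].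
Qed.

End WalkExpectation.

(** * Kolmogorov's maximal inequality *)

Section Maximal.
Context {disp : measure_display} {T : measurableType disp} {R : realType} {d : nat}.
Variables (P : probability T R) (X : nat -> T -> 'rV[int]_d).
Hypotheses (X_iid : iid_steps P X)
  (X_centered : forall j : 'I_d, ('E_P[fun w => ((X 0%N w) ord0 j)%:~R] = 0)%E)
  (X_moments : forall k : nat, ('E_P[fun w => (enorm R (X 0%N w) ^+ k)%R] < +oo)%E).
Local Notation V := 'rV[int]_d.
Local Notation E := (step_mean P X).

Variables (D : V -> V -> R) (good : set V) (lam sig2 : R).
Hypotheses (lam0 : 0 < lam) (sig0 : 0 <= sig2)
  (D_grows : forall x, good x -> grows (D x))
  (D2_grows : forall x, good x -> grows (fun v => D x v ^+ 2))
  (D_mean : forall x, good x -> E (D x) = 0)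
  (D_var : forall x, good x -> E (fun v => D x v ^+ 2) <= sig2).

(* The martingale with increments [D (walk n) (X n)], frozen once it leaves
   [(- lam, lam)] or the walk leaves [good]. *)
Definition stopped_step (s : V * R) (v : V) : V * R :=
  (s.1 + v, if `[< good s.1 >] && (`|s.2| < lam) then s.2 + D s.1 v else s.2).

Definition stopped (h : seq V) : V * R := foldl stopped_step (0, 0) h.

Let st n w := stopped (history X n w).

Let stS n w : st n.+1 w = stopped_step (st n w) (X n w).
Proof. by rewrite /st historyS /stopped foldl_rcons. Qed.

Let st1 n w : (st n w).1 = walk X n w.
Proof.
elim: n => [|n IH]; first by rewrite /walk big_ord0.
by rewrite stS /= IH /walk big_ord_recr.
Qed.

Let mst d' (U : measurableType d') (f : V * R -> U) n :
  measurable_fun setT (fun w => f (st n w)).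
Proof.
apply: (@discrete_measurable _ _ _ (history X n) _ _ (fun h => f (stopped h))) => //.
exact: (history_discrete X_iid).
Qed.

(** While the process runs, its increment is centered given the past, so the cross term vanishes and
    a step adds at most [sig2]. Whether the position is in [good] is tested before each step, so the
    assumptions on [D x] are used only for good x. *)
Lemma stopped_second_moment n :
  (\int[P]_w ((stopped (history X n w)).2 ^+ 2)%:E <= (n%:R * sig2)%:E)%E.
Proof.
elim: n => [|n IH].
  rewrite mul0r integral0_eq// => w _ /=; by rewrite expr0n.
under eq_integral do rewrite -/(st _ _) stS.
rewrite (integral_history X_iid n (g := fun h v => ((stopped_step (stopped h) v).2 ^+ 2)%:E));
  last by move=> h v; rewrite lee_fin sqr_ge0.
apply: (@le_trans _ _ (\int[P]_w (((st n w).2 ^+ 2)%:E + sig2%:E))%E).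
  have EL := step_mean_law X_iid X_centered X_moments.
  apply: ge0_le_integral => //.
  - by move=> w _; apply: integral_ge0 => w' _; rewrite lee_fin sqr_ge0.
  - apply: (@discrete_measurable _ _ _ (history X n) _ _ (fun h =>
      \int[P]_w' ((stopped_step (stopped h) (X 0%N w')).2 ^+ 2)%:E)%E) => //.
    exact: (history_discrete X_iid).
  - exact: (mst (fun s => (s.2 ^+ 2)%:E + sig2%:E)%E).
  move=> w _; rewrite -/(st n w); case: (st n w) => x y /=.
  case: (boolP (`[< good x >] && (`|y| < lam))) => [/andP[/asboolP gx _]|_]; last first.
    by rewrite integral_cst//= (@probability_setT _ _ _ P) mule1 leeDl// lee_fin.
  have gD : grows (fun v => y + D x v) by apply: growsD; [exact: grows_cst|exact: D_grows].
  have e : (fun v => (y + D x v) ^+ 2) = fun v => 2 * y * D x v + (y ^+ 2 + D x v ^+ 2).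
    by apply/funext => v; ring.
  have g3 : grows (fun v => y ^+ 2 + D x v ^+ 2).
    by apply: growsD; [exact: grows_cst|exact: D2_grows].
  rewrite (step_meanE X_iid X_moments (f := fun v => (y + D x v) ^+ 2)) e.
    rewrite (step_lin EL)//; last exact: D_grows.
    rewrite D_mean// mulr0 add0r (stepD EL) ?(step_cst EL)//; last 2 first.
    - exact: grows_cst.
    - exact: D2_grows.
    by rewrite -EFinD lee_fin lerD2l D_var.
  by apply: growsD => //; apply: growsZ; exact: D_grows.
rewrite ge0_integralD//; last 2 first.
- by move=> w _; rewrite lee_fin sqr_ge0.
- exact: (mst (fun s => (s.2 ^+ 2)%:E)).
have -> : (\int[P]_w sig2%:E = sig2%:E)%E.
  by rewrite integral_cst// -[RHS]mule1; congr (_ * _)%E; exact: probability_setT.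
rewrite -natr1 mulrDl mul1r EFinD.
exact: leeD.
Qed.

Lemma maximal_inequality (N : nat) : exists A : set T,
  [/\ measurable A, (P A <= (N%:R * sig2 / lam ^+ 2)%:E)%E &
   forall w, ~ A w -> forall n, (n <= N)%N -> (forall i, (i < n)%N -> good (walk X i w)) ->
     `|\sum_(i < n) D (walk X i w) (X i w)| < lam].
Proof.
exists [set w | lam <= `|(st N w).2|].
have mA : measurable [set w | lam <= `|(st N w).2|].
  exact: (history_discrete X_iid N [set h | lam <= `|(stopped h).2|]).
split => //.
  rewrite EFinM lee_pdivlMr ?exprn_gt0//; apply: le_trans (stopped_second_moment N).
  rewrite muleC -[X in (_ * P X)%E]setIT -integral_indic// -ge0_integralZl//; last 2 first.
  - exact/measurable_EFinP.
  - by rewrite lee_fin sqr_ge0.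
  apply: ge0_le_integral => //.
  - by move=> w _; rewrite -EFinM lee_fin mulr_ge0 ?sqr_ge0.
  - apply: measurable_funeM; exact/measurable_EFinP.
  - exact: (mst (fun s => (s.2 ^+ 2)%:E)).
  move=> w _; rewrite -EFinM lee_fin indicE.
  have [/set_mem /= h|_] := boolP (w \in _); last by rewrite mulr0 sqr_ge0.
  by rewrite mulr1 -[leRHS]real_normK ?num_real// lerXn2r ?nnegrE// ltW.
move=> w /negP; rewrite -ltNge => hN.
have below n : (n <= N)%N -> `|(st n w).2| < lam.
  move=> nN; have [//|h] := ltP `|(st n w).2| lam.
  suff : forall k, st (n + k) w = (walk X (n + k) w, (st n w).2).
    by move=> /(_ (N - n)%N); rewrite subnKC// => e; move: hN; rewrite e /= ltNge h.
  elim=> [|k IH]; first by rewrite addn0 -st1; case: (st n w).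
  rewrite addnS stS {1}IH /stopped_step /= [(`|_| < lam)]ltNge h andbF.
  by rewrite -st1 -st1 stS.
move=> n nN hg; suff <- : (st n w).2 = \sum_(i < n) D (walk X i w) (X i w) by exact: below.
elim: n nN hg => [|n IH] nN hg; first by rewrite big_ord0.
rewrite stS big_ord_recr /= -IH ?(ltnW nN)//; last by move=> i /ltnW; exact: hg.
rewrite st1 below ?(ltnW nN)// andbT.
by case: asboolP => // /(_ (hg n (ltnSn n))).
Qed.

End Maximal.

(** * Subgroups and greatest common divisors *)

Section Subgroup.
Variables (G : zmodType) (H : set G).
Hypothesis HG : is_subgroup H.

Lemma subgroup0 : H 0. Proof. by case: HG. Qed.

Lemma subgroupB x y : H x -> H y -> H (x - y). Proof. by case: HG => _; apply. Qed.

Lemma subgroupN x : H x -> H (- x).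
Proof. by move=> hx; rewrite -sub0r; exact: subgroupB subgroup0 hx. Qed.

Lemma subgroupD x y : H x -> H y -> H (x + y).
Proof. by move=> hx hy; rewrite -[y]opprK; exact/subgroupB/subgroupN. Qed.

Lemma subgroup_sum (n : nat) (f : nat -> G) : (forall i, (i < n)%N -> H (f i)) ->
  H (\sum_(i < n) f i).
Proof. by move=> hf; apply: big_ind => //; [exact: subgroup0|exact: subgroupD|move=> i _; exact: hf]. Qed.

Lemma subgroupMn x n : H x -> H (x *+ n).
Proof.
by move=> hx; elim: n => [|n IH]; [exact: subgroup0|rewrite mulrS; exact: subgroupD].
Qed.

(** By Euclidean division the least m > 0 with [x *+ m] in H divides every n in A, hence divides
    1. *)
Lemma subgroup_gcd (x : G) (A : set nat) : is_gcd A 1 ->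
  (forall n, A n -> (0 < n)%N /\ H (x *+ n)) -> H x.
Proof.
move=> [_ gA] hA.
have [n0 An0] : exists n, A n.
  apply: contrapT => no; suff : (0 %| 1)%N by [].
  by apply: gA => n An; exfalso; apply: no; exists n.
have ex : exists n, (0 < n)%N && `[< H (x *+ n) >].
  by exists n0; have [-> hn] := hA _ An0; exact/asboolP.
case: (ex_minnP ex) => m /andP[m0 /asboolP hm] mmin.
suff : (m %| 1)%N by rewrite dvdn1 => /eqP m1; rewrite m1 mulr1n in hm.
apply: gA => n /hA[_ hn]; rewrite /dvdn; apply/negPn/negP; rewrite -lt0n => r0.
have := mmin (n %% m)%N; rewrite r0 /= leqNgt ltn_pmod//= => /(_ _)/negP; apply => //.
apply/asboolP; rewrite -[x *+ (n %% m)](addKr (x *+ (n %/ m * m))) -mulrnDr -divn_eq addrC.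
by apply: subgroupB => //; rewrite mulnC mulrnA; exact: subgroupMn.
Qed.

End Subgroup.

(** * Smoothing for the given walk *)

Section SmoothingOfWalk.
Context {disp : measure_display} {T : measurableType disp} {R : realType} {d : nat}.
Variables (P : probability T R) (X : nat -> T -> 'rV[int]_d).
Hypotheses (X_iid : iid_steps P X)
  (X_centered : forall j : 'I_d, ('E_P[fun w => ((X 0%N w) ord0 j)%:~R] = 0)%E)
  (X_moments : forall k : nat, ('E_P[fun w => (enorm R (X 0%N w) ^+ k)%R] < +oo)%E)
  (X_nondeg : nondegenerate_step P X) (X_aper : aperiodic_walk P X).
Local Notation V := 'rV[int]_d.

Let X_disc n : discrete (X n). Proof. by have [h _ _] := X_iid; exact: h. Qed.

Lemma outside_support_negligible n :
  P.-negligible [set w | ~ law_support P (X 0%N) (X n w)].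
Proof.
rewrite (_ : [set w | _] = \bigcup_k (if choice.unpickle k is Some v then
   (if `[< law_support P (X 0%N) v >] then set0 else X n @^-1` [set v]) else set0)).
  apply: negligible_bigcup => k; case: choice.unpickle => [v|]; last exact: negligible_set0.
  case: asboolP => hv; first exact: negligible_set0.
  apply/negligibleP; first exact: X_disc.
  have [_ _ idd] := X_iid; apply: (eq_trans (idd n [set v])); apply/eqP; move/negP: hv; rewrite /law_support /= -leNgt.
  by rewrite -measure_le0.
apply/seteqP; split => w /=.
  by move=> h; exists (choice.pickle (X n w)) => //=; rewrite choice.pickleK; case: asboolP.
by move=> [k _]; case: choice.unpickle => // v; case: asboolP => // nv ->.
Qed.

(** Turns positive probability into one concrete closed path through possible steps, to which
    algebra applies. *)
Lemma return_path n : (0 < P (walk X n @^-1` [set 0%R]))%E ->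
  exists2 w, walk X n w = 0 & forall i, law_support P (X 0%N) (X i w).
Proof.
move=> h; apply: contrapT => no.
have mW : measurable (walk X n @^-1` [set 0]).
  have -> : walk X n = fun w => \sum_(v <- history X n w) v.
    by apply/funext => w; rewrite /history big_map -[in RHS](subn0 n) big_mkord.
  exact: (history_discrete X_iid n [set h | \sum_(v <- h) v = 0]).
suff : P (walk X n @^-1` [set 0]) = 0%E by move=> e; rewrite e ltxx in h.
apply/negligibleP => //.
apply: negligibleS (negligible_bigcup outside_support_negligible) => w /= w0.
apply: contrapT => nw; apply: no; exists w => // i; apply: contrapT => ni; apply: nw.
by exists i.
Qed.

(** Differences of possible steps are smoothable. If n possible steps sum to 0, then n x is minus
    the sum of the differences X_i - x, hence smoothable; aperiodicity extends this to x, and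
    non-degeneracy to Z^d. *)
Lemma walk_smoothing :
  exists2 C, 0 <= C & forall v, smoothing (step_mean P X) v (C * l1norm v).
Proof.
have EL := step_mean_law X_iid X_centered X_moments.
apply: smoothing_l1norm => v.
pose H : set V := smoothable (step_mean P X).
have HG : is_subgroup H by exact: smoothable_subgroup.
suff : H v by [].
have supp x y : law_support P (X 0%N) x -> law_support P (X 0%N) y -> H (x - y).
  by move=> hx hy; apply: smoothing_score => //; exact: step_mass_gt0.
suff sub : law_support P (X 0%N) `<=` H.
  have : smallest (@is_subgroup V) (law_support P (X 0%N)) v by rewrite X_nondeg.
  by apply; split.
move=> x hx; apply: (subgroup_gcd HG X_aper) => n [n0 /return_path[w w0 hw]]; split => //.
rewrite -[_ *+ n]opprK; apply: subgroupN => //.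
rewrite (_ : - _ = \sum_(i < n) (X i w - x)).
  by apply: (@subgroup_sum _ _ HG n (fun i => X i w - x)) => i _; exact: supp.
by rewrite sumrB -/(walk X n w) w0 sumr_const card_ord sub0r.
Qed.

End SmoothingOfWalk.

(** * Averages over lattice cubes *)

Section Boxes.
Context {R : realType} {d : nat}.
Local Notation V := 'rV[int]_d.

(** The products with 0 and 1 make this literally the box of the hypothesis on averages for a = 0, b
    = 1, L = l. *)
Definition cube (l : nat) : set V :=
  lattice_box (fun _ : 'I_d => 0 * l%:R : R) (fun _ => 1 * l%:R).

Lemma cubeP l v : cube l v <-> forall j, 0 <= v ord0 j <= l%:Z.
Proof.
by split => h j; have := h j; rewrite mul0r mul1r ler0z -(ler_int R).
Qed.

Lemma cube_finite l : finite_set (cube l).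
Proof.
apply: (@sub_finite_set _ _ ((fun g : {ffun 'I_d -> 'I_l.+1} =>
   (\row_j (g j : nat)%:Z : V)) @` setT)); last exact/finite_image/finite_finset.
move=> v /cubeP hv; exists [ffun j => inord `|v ord0 j|%N] => //.
apply/rowP => j; rewrite mxE ffunE inordK; have /andP[h0 hl] := hv j.
  by rewrite gez0_abs.
by rewrite ltnS -lez_nat gez0_abs.
Qed.

Definition box (l : nat) : seq V := fset_set (cube l).

Lemma mem_cube l v : v \in box l -> cube l v.
Proof. by rewrite in_fset_set ?inE//; exact: cube_finite. Qed.

Lemma size_box l : (0 < size (box l))%N.
Proof.
have : 0 \in box l.
  rewrite in_fset_set; last exact: cube_finite.
  by rewrite inE; apply/cubeP => j; rewrite mxE lexx.
by case: (box l).
Qed.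

Lemma box_norms l v : v \in box l ->
  l1norm v <= d%:R * l%:R :> R /\ sqnorm v <= d%:R * l%:R ^+ 2 :> R.
Proof.
move=> /mem_cube/cubeP hv.
have b j : 0 <= ((v ord0 j)%:~R : R) <= l%:R.
  by rewrite ler0z -[l%:R]/(l%:Z%:~R) ler_int; exact: hv.
split.
  rewrite /l1norm -[d in leRHS]card_ord mulrC mulr_natr -sumr_const; apply: ler_sum => j _.
  by have /andP[h0 hl] := b j; rewrite ger0_norm.
rewrite /sqnorm -[d in leRHS]card_ord mulrC mulr_natr -sumr_const; apply: ler_sum => j _.
by have /andP[h0 hl] := b j; rewrite lerXn2r ?nnegrE.
Qed.

Lemma average_cube (F : V -> R) z l : average F (translate z (cube l)) = shift_avg (box l) F z.
Proof.
rewrite /average /translate fset_set_image; last exact: cube_finite.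
rewrite card_imfset; last by move=> u v /addrI.
by rewrite big_imfset//= => u v _ _ /addrI.
Qed.

(** The exponent is written - 2 a with a = d (1 - beta) / 2, so that cubes of side sqrt m give m^(-
    a). *)
Lemma average_boundP (beta gamma : R) (F : V -> R) :
  average_bound beta gamma F 0 -> exists2 C, 0 <= C &
  forall l z, (0 < l)%N -> sqnorm z < (l%:R `^ gamma) ^+ 2 ->
    `|shift_avg (box l) F z| <= C * l%:R `^ (- (2 * (d%:R * (1 - beta) / 2))).
Proof.
move=> /(_ (fun=> 0) (fun=> 1))[j|C hC]; first exact: ltr01.
exists `|C| => // l z l0 zl.
have := hC l%:R z; rewrite ltr0n l0 subr0 average_cube.
rewrite (_ : d%:R * (beta - 1) = - (2 * (d%:R * (1 - beta) / 2))); last by field.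
move=> h; apply: le_trans (ltW (h _ _ _)) _ => //.
- by rewrite /enorm -[ltRHS]gtr0_norm ?powR_gt0 ?ltr0n// -sqrtr_sqr ltr_sqrt// exprn_gt0// powR_gt0 ?ltr0n.
- by exists 0; apply/cubeP => j; rewrite mxE lexx.
- by rewrite ler_wpM2r ?powR_ge0// ler_norm.
Qed.

End Boxes.

(** * Estimates at a fixed time scale *)

Section FixedScale.
Context {disp : measure_display} {T : measurableType disp} {R : realType} {d : nat}.
Variables (P : probability T R) (X : nat -> T -> 'rV[int]_d).
Hypotheses (X_iid : iid_steps P X)
  (X_centered : forall j : 'I_d, ('E_P[fun w => ((X 0%N w) ord0 j)%:~R] = 0)%E)
  (X_moments : forall k : nat, ('E_P[fun w => (enorm R (X 0%N w) ^+ k)%R] < +oo)%E)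
  (X_nondeg : nondegenerate_step P X) (X_aper : aperiodic_walk P X).
Local Notation V := 'rV[int]_d.
Local Notation E := (step_mean P X).
Local Notation Q := (step_op E).

Let EL : step_law E. Proof. exact: step_mean_law. Qed.

Let sig0 : 0 <= E sqnorm.
Proof. by apply: (step_ge0 EL); [exact: grows_sqnorm|exact: sqnorm_ge0]. Qed.

(** Each coordinate of the walk is a martingale, to which the maximal inequality applies with no
    restriction on positions; a union bound over coordinates gives the factor d. *)
Lemma walk_confined (lam : R) N : 0 < lam -> exists A : set T,
  [/\ measurable A, (P A <= (d%:R * (N%:R * E sqnorm / lam ^+ 2))%:E)%E &
    forall w, ~ A w -> forall n, (n <= N)%N -> sqnorm (walk X n w) <= d%:R * lam ^+ 2].
Proof.
move=> lam0.
have coord2 (j : 'I_d) : grows (fun v : V => ((v ord0 j)%:~R : R) ^+ 2).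
  apply: le_grows grows_sqnorm => v; rewrite ger0_norm ?sqr_ge0//; exact: coord_le_sqnorm.
have mx (j : 'I_d) := @maximal_inequality _ _ _ _ P X X_iid X_centered X_moments
  (fun _ v => (v ord0 j)%:~R) setT lam (E sqnorm) lam0 sig0 (fun _ _ => grows_coord j)
  (fun _ _ => coord2 j) (fun _ _ => step_mean0 EL j)
  (fun _ _ => step_le EL (coord2 j) grows_sqnorm (coord_le_sqnorm j)) N.
have [A hA] := choice mx.
have mA j : measurable (A j) by have [] := hA j.
exists (\big[setU/set0]_(j < d) A j); split; first exact: bigsetU_measurable.
  apply: (@le_trans _ _ (\sum_(j < d) P (A j))%E).
    elim: (index_enum _) => [|j js IH]; first by rewrite !big_nil measure0.
    rewrite !big_cons; apply: le_trans (measureU2 _ (mA j) _) _.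
      exact: bigsetU_measurable.
    exact: leeD2l.
  apply: (@le_trans _ _ (\sum_(j < d) (N%:R * E sqnorm / lam ^+ 2)%:E)%E).
    by apply: lee_sum => j _; have [_ h _] := hA j; exact: h.
  by rewrite sumEFin sumr_const card_ord lee_fin -[X in X <= _]mulr_natl.
move=> w nA n nN.
have nAj j : ~ A j w by move=> h; apply: nA; rewrite (bigD1 j)//=; left.
rewrite /sqnorm -[d in leRHS]card_ord mulrC mulr_natr -sumr_const; apply: ler_sum => j _.
have [_ _ /(_ _ (nAj j) n nN (fun _ _ => I)) h] := hA j.
rewrite -[leLHS]real_normK ?num_real// lerXn2r ?nnegrE ?(ltW lam0)//.
apply: ltW; rewrite (_ : _%:~R = \sum_(i < n) ((X i w) ord0 j)%:~R)//.
by rewrite /walk summxE rmorph_sum.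
Qed.

Lemma fixed_scale (beta gamma rho eps : R) (F : V -> R) :
  beta < 1 -> 0 < eps -> 0 <= gamma ->
  2^-1 <= rho -> 1 - d%:R * (1 - beta) / 2 <= rho -> 1 <= (rho - 2^-1 + eps) * gamma ->
  (exists B, forall z, `|F z| <= B) -> average_bound beta gamma F 0 ->
  exists K eta tau : R, [/\ 0 <= K, 0 < eta, 0 < tau & forall N, (0 < N)%N ->
    exists A : set T, [/\ measurable A,
      (P A <= (K * (harmonic_sum R N ^+ 2 * N%:R `^ (- (2 * eta)) + N%:R `^ (- tau)))%:E)%E &
      forall w, ~ A w -> forall n, (n <= N)%N ->
        `|ergodic_sum F X n w| <= K * N%:R `^ (rho + eps - eta)]].
Proof.
move=> b1 e0 g0 rho1 rho2 sg [B hB] /average_boundP[CA CA0 hCA].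
have B0 : 0 <= B by exact: le_trans (normr_ge0 _) (hB 0).
have [C C0 hC] := walk_smoothing X_iid X_centered X_moments X_nondeg X_aper.
set a := d%:R * (1 - beta) / 2 in rho2 hCA.
have a0 : 0 <= a by rewrite !mulr_ge0// subr_ge0 ltW.
(* Up to [eta], this is the exponent in |Q^m F| <= N^s / sqrt m near the origin; multiplication by
   sqrt N gives the target N^(rho + eps). *)
pose s := rho - 2^-1 + eps; have s0 : 0 < s by rewrite /s; lra.
have [delta [dl0 dl1 dls]] : exists delta : R, [/\ 0 < delta, 8 * delta <= 1 & 8 * delta <= s].
  by exists (Num.min s 1 / 8); split; case: (leP s 1) => ?; lra.
(* As s gamma >= 1, kappa gamma >= 1 - delta: cubes of side N^kappa are controlled up to distance
   N^(1 - delta), beyond the N^(1/2 + delta) allowed to the walk. *)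
pose kappa := (1 - delta) * s.
(* The first bound gives kappa + eta <= s - eta = theta. The second keeps the loss 2 a eta from
   shortening the cubes, together with eta itself, below eps. *)
pose eta := Num.min (delta * s / 2) (eps / (1 + 2 * a)).
have ds0 : 0 < delta * s by exact: mulr_gt0.
have a1 : 0 < 1 + 2 * a by rewrite ltr_pwDl// mulr_ge0.
have eta0 : 0 < eta by rewrite lt_min !divr_gt0.
have eta1 : eta <= delta * s / 2 by rewrite ge_min lexx.
have eta2 : eta * (1 + 2 * a) <= eps by rewrite -ler_pdivlMr// ge_min lexx orbT.
have ds8 : 8 * (delta * s) <= s by have := ler_wpM2r (ltW s0) dl1; lra.
have aeta : 0 <= a * eta by rewrite mulr_ge0// ltW.
pose theta := s - eta.
have eps_s : eps <= s by rewrite /s; lra.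
have th0 : 0 <= theta by rewrite /theta; lra.
have [K0 K00 dec] : exists2 K, 0 <= K & forall N m x, (0 < m <= N)%N ->
    `|iter m Q F x| <= K * (N%:R `^ theta / Num.sqrt m%:R +
       N%:R `^ (- (2 * (1 - delta))) * (sqnorm x + N%:R)).
  apply: (@iter_decay R d E C F B box CA a gamma EL C0 hC hB _ _ a0 g0 CA0 hCA kappa eta theta delta) => //.
  - exact: size_box.
  - exact: box_norms.
  - by rewrite /kappa mulr_ge0// ?(ltW s0)//; lra.
  - by rewrite /kappa /theta; lra.
  - by rewrite /theta /s; lra.
  - by rewrite /theta /s; lra.
  - rewrite /kappa -mulrA -[leLHS]mulr1 ler_wpM2l//; lra.
pose Kd := 2 * C * K0 + C * K0 + K0 * (3 + 2 * E sqnorm).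
pose M4 := E (fun v => (1 + sqnorm v) ^+ 2).
pose K1 := ((2 * B + Kd) * (d%:R + 3)) ^+ 2 * M4.
pose K2 := 1 + K0 * (5 + 3 * (d%:R + 1)).
pose K := K1 + d%:R * E sqnorm + K2.
have Kd0 : 0 <= Kd by rewrite !addr_ge0 ?mulr_ge0 ?addr_ge0 ?mulr_ge0.
have M40 : 0 <= M4 by apply: (step_ge0 EL) => [|v]; [exact: grows_sqnorm2|exact: sqr_ge0].
have K10 : 0 <= K1 by rewrite mulr_ge0 ?sqr_ge0.
have K20 : 0 <= K2.
  by rewrite addr_ge0// mulr_ge0//; have := ler0n R d; lra.
have dE0 : 0 <= d%:R * E sqnorm by rewrite mulr_ge0.
(* The threshold [lam] lies a factor N^(eta / 2) below the target and as much above sqrt N * Theta,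
   so Chebyshev gives N^(- eta) up to the harmonic factor. Leaving the ball of radius of order
   N^(1/2 + delta) has probability of order at most N^(- 2 delta). *)
exists K, (eta / 2), (2 * delta); split.
- exact: addr_ge0 (addr_ge0 K10 dE0) K20.
- by rewrite divr_gt0.
- by rewrite mulr_gt0.
move=> N N0.
have N1 : 1 <= N%:R :> R by rewrite ler1n.
have Np : 0 < N%:R :> R by rewrite ltr0n.
have ND r t : N%:R `^ (r + t) = N%:R `^ r * N%:R `^ t :> R.
  by rewrite powRD// (gt_eqF Np) implybT.
pose Theta : R := N%:R `^ theta; pose kN : R := N%:R `^ (- (2 * (1 - delta))).
have Theta1 : 1 <= Theta by have := ler_powR N1 th0; rewrite powRr0.
have kN0 : 0 <= kN by exact: powR_ge0.
pose u := corrector E F N.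
pose lam0 : R := N%:R `^ (2^-1 + delta); have lam00 : 0 < lam0 by exact: powR_gt0.
pose r := d%:R * lam0 ^+ 2.
have lam0E : lam0 ^+ 2 = N%:R `^ (1 + 2 * delta).
  by rewrite -powR_mulrn ?powR_ge0// -powRrM; congr (_ `^ _); field.
(* Inside the ball the quadratic error has exponent 1 - 2 (1 - delta) + (1 + 2 delta) = 4 delta,
   which 8 delta <= s brings below theta. *)
have rN : N%:R * kN * (r + N%:R) <= (d%:R + 1) * Theta.
  have h1 : N%:R <= lam0 ^+ 2.
    by rewrite lam0E -[leLHS]powRr1// ler_powR//; lra.
  apply: (@le_trans _ _ (N%:R * kN * ((d%:R + 1) * lam0 ^+ 2))).
    by rewrite ler_wpM2l ?mulr_ge0// /r mulrDl mul1r lerD2l.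
  rewrite mulrCA ler_wpM2l ?addr_ge0// lam0E /kN -[X in X * _ * _]powRr1// -!ND.
  by apply: ler_powR => //; rewrite /theta; lra.
have h1 : 1 <= harmonic_sum R N.
  rewrite /harmonic_sum -(prednK N0) big_ord_recl /= invr1 lerDl.
  by apply: sumr_ge0 => i _; rewrite invr_ge0.
set h := harmonic_sum R N in h1 *.
pose lam : R := N%:R `^ (rho + eps - eta / 2).
have lamp : 0 < lam by exact: powR_gt0.
pose sig2 := ((2 * B + Kd) * (1 + Theta * h + (d%:R + 1) * Theta)) ^+ 2 * M4.
have sig20 : 0 <= sig2 by rewrite mulr_ge0 ?sqr_ge0.
pose D x v := u (x + v) - Q u x.
have uB x : `|u x| <= N%:R * B by exact: corrector_bound.
have DB x v : `|D x v| <= N%:R * B + `|Q u x|.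
  exact: le_trans (ler_normB _ _) (lerD (uB _) _).
have [A [mA PA hA]] : exists A : set T,
  [/\ measurable A, (P A <= (N%:R * sig2 / lam ^+ 2)%:E)%E &
   forall w, ~ A w -> forall n, (n <= N)%N ->
     (forall i, (i < n)%N -> sqnorm (walk X i w) <= r) ->
     `|\sum_(i < n) D (walk X i w) (X i w)| < lam].
  apply: (maximal_inequality X_iid X_centered X_moments (D := D)
    (good := [set x | sqnorm x <= r]) lamp sig20) => //.
  - by move=> x _; apply: bounded_grows (DB x).
  - move=> x _; apply: (bounded_grows (B := (N%:R * B + `|Q u x|) ^+ 2)) => v.
    by rewrite normrX lerXn2r ?nnegrE ?addr_ge0 ?mulr_ge0.
  - by move=> x _; exact: (@corrector_mean0 R d E F B N EL hB x).
  move=> x /= xr.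
  apply: le_trans (corrector_variance EL C0 K00 hC hB N0 Theta1 kN0 (dec N) x) _.
  have Th0 : 0 <= Theta * h by rewrite mulr_ge0 ?(le_trans _ Theta1) ?(le_trans _ h1).
  have kx0 : 0 <= N%:R * kN * (sqnorm x + N%:R) by rewrite !mulr_ge0 ?addr_ge0 ?sqnorm_ge0.
  have kx : N%:R * kN * (sqnorm x + N%:R) <= (d%:R + 1) * Theta.
    by apply: le_trans rN; rewrite ler_wpM2l ?mulr_ge0// lerD2r.
  have BK0 : 0 <= 2 * B + Kd by rewrite addr_ge0// mulr_ge0.
  have Tp : 0 <= (d%:R + 1) * Theta by rewrite mulr_ge0 ?addr_ge0// (le_trans _ Theta1).
  rewrite -/h ler_wpM2r// lerXn2r ?nnegrE//; last by rewrite ler_wpM2l// lerD2l.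
    by rewrite mulr_ge0// !addr_ge0.
  by rewrite mulr_ge0// !addr_ge0.
have [A' [mA' PA' hA']] := walk_confined N lam00.
exists (A `|` A'); split; first exact: measurableU.
  apply: (@le_trans _ _ (P A + P A')%E); first exact: measureU2.
  apply: le_trans (leeD PA PA') _; rewrite -EFinD lee_fin.
  have Th : sig2 <= K1 * (Theta * h) ^+ 2.
    have Tp : 0 <= Theta by exact: le_trans Theta1.
    have t1 : Theta <= Theta * h by rewrite ler_peMr.
    have t2 := ler_wpM2l (ler0n R d) t1.
    have BK0 : 0 <= 2 * B + Kd by rewrite addr_ge0// mulr_ge0.
    have d0 := ler0n R d; have dT := mulr_ge0 d0 Tp.
    have G0 : 0 <= 1 + Theta * h + (d%:R + 1) * Theta by move: Theta1 t1 dT; lra.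
    have Gle : 1 + Theta * h + (d%:R + 1) * Theta <= (d%:R + 3) * (Theta * h).
      by move: Theta1 t1 t2; lra.
    rewrite /K1 mulrAC -exprMn ler_wpM2r//.
    have M0 : 0 <= (2 * B + Kd) * (1 + Theta * h + (d%:R + 1) * Theta) by exact: mulr_ge0.
    have Mle : (2 * B + Kd) * (1 + Theta * h + (d%:R + 1) * Theta) <=
        (2 * B + Kd) * (d%:R + 3) * (Theta * h) by rewrite -[leRHS]mulrA ler_wpM2l.
    by rewrite lerXn2r// nnegrE// (le_trans M0 Mle).
  have p1 : N%:R * sig2 / lam ^+ 2 <= K1 * (h ^+ 2 * N%:R `^ (- (2 * (eta / 2)))).
    rewrite ler_pdivrMr ?exprn_gt0//; apply: le_trans (ler_wpM2l (ltW Np) Th) _.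
    rewrite [leLHS](_ : _ = K1 * h ^+ 2 * (N%:R * Theta ^+ 2)); last by ring.
    rewrite [leRHS](_ : _ = K1 * h ^+ 2 * (N%:R `^ (- (2 * (eta / 2))) * lam ^+ 2)); last by ring.
    apply: ler_wpM2l; first by apply: mulr_ge0 => //; exact: sqr_ge0.
    have -> : N%:R * Theta ^+ 2 = N%:R `^ (1 + theta * 2).
      by rewrite ND powRr1// powRrM (powR_mulrn 2) ?powR_ge0.
    have -> : lam ^+ 2 = N%:R `^ ((rho + eps - eta / 2) * 2).
      by rewrite powRrM (powR_mulrn 2) ?powR_ge0.
    by rewrite -ND; apply: ler_powR => //; rewrite /theta /s; lra.
  have p2 : d%:R * (N%:R * E sqnorm / lam0 ^+ 2) <= d%:R * E sqnorm * N%:R `^ (- (2 * delta)).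
    rewrite mulrA ler_pdivrMr ?exprn_gt0// lam0E -[leRHS]mulrA -ND.
    rewrite [- _ + _](_ : _ = 1) ?powRr1//; last by ring.
    by rewrite le_eqVlt; apply/orP; left; apply/eqP; ring.
  apply: le_trans (lerD p1 p2) _; rewrite mulrDr /K.
  have q0 : 0 <= h ^+ 2 * N%:R `^ (- (2 * (eta / 2))) by rewrite mulr_ge0 ?sqr_ge0 ?powR_ge0.
  have q1 : 0 <= N%:R `^ (- (2 * delta)) :> R by exact: powR_ge0.
  apply: lerD; apply: ler_wpM2r => //.
    by rewrite -addrA lerDl; exact: addr_ge0.
  by rewrite [K1 + _]addrC -addrA lerDl; exact: addr_ge0.
move=> w /not_orP[nA nA'] n nN.
have conf i : (i <= n)%N -> sqnorm (walk X i w) <= r.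
  by move=> ni; apply: hA' => //; exact: leq_trans ni nN.
have mart := hA w nA n nN (fun i ni => conf i (ltnW ni)).
have := path_sum_bound EL K00 hB N0 Theta1 kN0 (dec N) nN conf (lam := lam).
rewrite (eq_bigr (fun i : 'I_n => D (walk X i w) (X i w))); last first.
  by move=> i _; rewrite /D /walk big_ord_recr.
move=> /(_ (ltW mart)) /le_trans; apply.
have l1 : Theta * Num.sqrt N%:R <= lam.
  rewrite -powR12_sqrt ?ler0n// -ND; apply: ler_powR => //; rewrite /theta /s; lra.
have l2 : N%:R * kN * (r + N%:R) <= (d%:R + 1) * lam.
  apply: le_trans rN _; rewrite ler_wpM2l ?addr_ge0//.
  by apply: ler_powR => //; rewrite /theta /s; lra.
apply: (@le_trans _ _ (K2 * lam)); last first.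
  apply: ler_wpM2r; first exact: ltW.
  by rewrite /K lerDr; exact: addr_ge0.
have l3 : 5 * Theta * Num.sqrt N%:R + 3 * (N%:R * kN * (r + N%:R)) <=
    (5 + 3 * (d%:R + 1)) * lam.
  by rewrite -[5 * Theta * _]mulrA; move: l1 l2; lra.
rewrite [leRHS](_ : _ = lam + K0 * ((5 + 3 * (d%:R + 1)) * lam)); last by rewrite /K2; ring.
by apply: lerD => //; exact: ler_wpM2l.
Qed.

End FixedScale.

(** * Dyadic times and almost sure convergence *)

Lemma harmonic_sum_ge0 (R : realType) n : 0 <= harmonic_sum R n.
Proof. by apply: sumr_ge0 => i _; rewrite invr_ge0. Qed.

Lemma harmonic_sum_double (R : realType) n : (0 < n)%N ->
  harmonic_sum R (n + n) <= harmonic_sum R n + 1.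
Proof.
move=> n0; rewrite /harmonic_sum big_split_ord /= lerD2l.
apply: (@le_trans _ _ (\sum_(i < n) n%:R^-1)).
  apply: ler_sum => i _; rewrite lef_pV2 ?posrE ?ltr0n// ler_nat.
  by rewrite -addnS leq_addr.
by rewrite sumr_const card_ord -[_ *+ n]mulr_natl divff// pnatr_eq0 -lt0n.
Qed.

Lemma harmonic_sum_dyadic (R : realType) k : harmonic_sum R (2 ^ k) <= k%:R + 1.
Proof.
elim: k => [|k IH]; first by rewrite /harmonic_sum big_ord_recl big_ord0 invr1 addr0 add0r.
rewrite expnS mul2n -addnn; apply: le_trans (harmonic_sum_double _ _) _.
  by rewrite expn_gt0.
by rewrite -[k.+1%:R]natr1 lerD2r.
Qed.

(** This is e^y >= 1 + y at y = p k ln 2; it absorbs the logarithmic factor of the variance. *)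
Lemma succ_le_powR (R : realType) (p : R) : 0 < p -> exists2 C, 0 <= C &
  forall k, k%:R + 1 <= C * (2 ^ k)%:R `^ p.
Proof.
move=> p0; have l2 : 0 < ln (2 : R) by rewrite ln_gt0// ltr1n.
have c0 : 0 < p * ln 2 by exact: mulr_gt0.
exists (1 + (p * ln 2)^-1); first by rewrite addr_ge0// invr_ge0 ltW.
move=> k; have -> : (2 ^ k)%:R `^ p = expR (p * ln 2 * k%:R) :> R.
  by rewrite /powR natrX expf_eq0 pnatr_eq0 andbF lnXn// -[ln 2 *+ k]mulr_natr mulrA.
apply: (@le_trans _ _ ((1 + (p * ln 2)^-1) * (1 + p * ln 2 * k%:R))).
  rewrite mulrDl mul1r [_^-1 * _]mulrDr mulr1 mulrA mulVf ?gt_eqF// mul1r.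
  have i0 : 0 <= (p * ln 2)^-1 by rewrite invr_ge0 ltW.
  have k0 : 0 <= p * ln 2 * k%:R by rewrite mulr_ge0// ltW.
  lra.
by rewrite ler_wpM2l ?addr_ge0 ?invr_ge0 ?(ltW c0)// expR_ge1Dx.
Qed.

Lemma borel_cantelli_geometric {disp : measure_display} {T : measurableType disp}
    {R : realType} (P : probability T R) (A : nat -> set T) (K q : R) :
  (forall k, measurable (A k)) -> 0 <= K -> 0 < q -> q < 1 ->
  (forall k, (P (A k) <= (K * q ^+ k)%:E)%E) ->
  {ae P, forall w, exists k0, forall k, (k0 <= k)%N -> ~ A k w}.
Proof.
move=> mA K0 q0 q1 PA.
have lim0 : P (lim_sup_set A) = 0%E.
  apply: lim_sup_set_cvg0 => //.
  apply: (@le_lt_trans _ _ (K * (1 - q)^-1)%:E); last by rewrite ltry.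
  apply: lime_le; first by apply: is_cvg_nneseries => k _ _; exact: measure_ge0.
  apply: nearW => n; apply: (@le_trans _ _ (\sum_(0 <= k < n) (K * q ^+ k)%:E)%E).
    by apply: lee_sum => k _; exact: PA.
  rewrite sumEFin lee_fin; have := @geometric_le_lim R n K q K0 q0.
  by rewrite ger0_norm ?(ltW q0)// => /(_ q1).
exists (lim_sup_set A); split => //.
  by apply: bigcapT_measurable => n; apply: bigcup_measurable => k _; exact: mA.
move=> w /= nw n _; apply: contrapT => no; apply: nw; exists n => k nk Akw.
by apply: no; exists k.
Qed.

(** The bound at level k covers all n <= 2^k, so n is compared with the next power of 2, which is at
    most 2 n. This costs 2^(p - nu), and [nu <= p] makes the power monotone. *)
Lemma cvg_of_dyadic_bound (R : realType) (u : nat -> R) (K p nu : R) (k0 : nat) :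
  0 <= K -> 0 < nu -> nu <= p ->
  (forall k, (k0 <= k)%N -> forall n, (n <= 2 ^ k)%N -> `|u n| <= K * (2 ^ k)%:R `^ (p - nu)) ->
  (fun n => u n / n%:R `^ p) @ \oo --> (0 : R).
Proof.
move=> K0 nu0 nup hu; apply/cvgr0Pnorm_le => e e0.
pose c := K * 2 `^ (p - nu); have c0 : 0 <= c by rewrite mulr_ge0 ?powR_ge0.
near=> n.
have n1 : (1 < n)%N by near: n; exact: nbhs_infty_gt.
have nk : (2 ^ k0 < n)%N by near: n; exact: nbhs_infty_gt.
have ne : (c / e) `^ nu^-1 <= n%:R by near: n; exact: nbhs_infty_ger.
pose k := up_log 2 n.
have nlek : (n <= 2 ^ k)%N by exact: up_logP.
have k0k : (k0 <= k)%N by rewrite -(leq_exp2l k0 k (ltnSn 1)) (leq_trans (ltnW nk)).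
have kn : (2 ^ k <= 2 * n)%N.
  have kp : (0 < k)%N by rewrite up_log_gt0 n1.
  by rewrite -(prednK kp) expnS leq_mul2l /= ltnW// up_log_gtn.
have np : 0 < n%:R :> R by rewrite ltr0n ltnW.
rewrite normrM normfV (ger0_norm (powR_ge0 _ _)) ler_pdivrMr ?powR_gt0//.
apply: le_trans (hu k k0k n nlek) _.
apply: (@le_trans _ _ (c * n%:R `^ (p - nu))).
  rewrite /c -mulrA -powRM// ler_wpM2l//.
  rewrite ge0_ler_powR ?nnegrE ?mulr_ge0 ?subr_ge0//.
  by rewrite -natrM ler_nat.
rewrite powRB; last by rewrite (gt_eqF np) implybT.
rewrite mulrA ler_pdivrMr ?powR_gt0// -mulrA mulrCA mulrC ler_wpM2l ?powR_ge0//.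
rewrite -ler_pdivrMl// mulrC.
have := @ge0_ler_powR _ nu (ltW nu0) _ _ _ _ ne.
rewrite -powRrM mulVf ?gt_eqF// powRr1 ?divr_ge0 ?(ltW e0)//; apply; rewrite nnegrE ?powR_ge0//.
Unshelve. all: by end_near.
Qed.

(** [rho_exponent] is the maximum of the two left-hand sides: the diffusive scale of the martingale
    and the scale set by the averages. *)
Lemma rho_exponent_bounds (R : realType) (d : nat) (beta : R) : (0 < d)%N ->
  2^-1 <= rho_exponent d beta /\ 1 - d%:R * (1 - beta) / 2 <= rho_exponent d beta.
Proof.
move=> d0; have dp : 0 < d%:R :> R by rewrite ltr0n.
by rewrite /rho_exponent ler_pdivlMr//; case: (leP (beta * d%:R)) => h; split; lra.
Qed.

(* The cubes of side [N ^ kappa] have to be controlled out to a distance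
   [N ^ (kappa * gamma)] close to [N], and [kappa] must stay below
   [rho - 1/2 + eps]: hence the last inequality. *)
Lemma usable_gamma (R : realType) (d : nat) (beta eps : R) (F : 'rV[int]_d -> R) :
  (0 < d)%N -> 0 <= beta -> 0 < eps -> has_Fbar beta (gamma_exponent d beta eps) F 0 ->
  exists gamma : R, [/\ 0 <= gamma, average_bound beta gamma F 0 &
    1 <= (rho_exponent d beta - 2^-1 + eps) * gamma].
Proof.
move=> d0 b0 e0; have [r1 r2] := rho_exponent_bounds beta d0.
have case_eps : average_bound beta (1 / eps) F 0 -> exists gamma : R,
    [/\ 0 <= gamma, average_bound beta gamma F 0 &
    1 <= (rho_exponent d beta - 2^-1 + eps) * gamma].
  move=> h; exists (1 / eps); split => //; first by rewrite divr_ge0// ltW.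
  by rewrite mulrA mulr1 ler_pdivlMr// mul1r; lra.
rewrite /gamma_exponent; case: eqP => [d1|_]; last exact: case_eps.
case: (eqVneq beta 0) => [_ h|bn0].
  by apply/case_eps/h; rewrite /= divr_gt0.
have bp : 0 < beta by rewrite lt_def bn0.
(* For d = 1, rho - 1/2 >= beta / 2, whence the exponent 2 / beta. *)
move=> h; exists (2 / beta); split => //; first by rewrite divr_ge0.
rewrite mulrA ler_pdivlMr// mul1r.
by move: r2; rewrite d1; lra.
Qed.

Lemma G_class_bounded (R : realType) (d : nat) (beta : R) gamma (F : 'rV[int]_d -> R) :
  G_class beta gamma F -> exists B, forall z, `|F z| <= B.
Proof.
have ex_B : [bounded F v | v in [set: 'rV[int]_d]] -> exists B, forall z, `|F z| <= B.
  by move=> /pinfty_ex_gt0[B B0 h]; exists B => z; exact: h.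
case: gamma => [g [h _]|h|[]]; first exact: ex_B.
by have [/ex_B] := h 1 ltr01.
Qed.

Theorem theorem1p4 (R : realType) (disp : measure_display)
    (T : measurableType disp) (P : probability T R)
    (d : nat) (X : nat -> T -> 'rV[int]_d)
    (d_gt0 : (0 < d)%N)
    (X_iid : iid_steps P X)
    (X_nondeg : nondegenerate_step P X)
    (X_aper : aperiodic_walk P X)
    (X_centered : forall j : 'I_d,
      ('E_P[fun w => ((X 0%N w) ord0 j)%:~R] = 0)%E)
    (X_moments : forall k : nat,
      ('E_P[fun w => (enorm R (X 0%N w) ^+ k)%R] < +oo)%E)
    (beta : R) (beta_ge0 : 0 <= beta) (beta_lt1 : beta < 1)
    (eps : R) (eps_gt0 : 0 < eps)
    (F : 'rV[int]_d -> R)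
    (F_in : G_class beta (gamma_exponent d beta eps) F)
    (F_bar0 : has_Fbar beta (gamma_exponent d beta eps) F 0) :
  {ae P, forall w,
    (fun N : nat => ergodic_sum F X N w / N%:R `^ (rho_exponent d beta + eps)) @ \oo
      --> (0 : R)}.
Proof.
have [gamma [g0 Fgamma sg]] := usable_gamma d_gt0 beta_ge0 eps_gt0 F_bar0.
have [rho1 rho2] := rho_exponent_bounds beta d_gt0.
have [K [eta [tau [K0 eta0 tau0 scale]]]] := fixed_scale X_iid X_centered X_moments X_nondeg
  X_aper beta_lt1 eps_gt0 g0 rho1 rho2 sg (G_class_bounded F_in) Fgamma.
(* With exponent eta / 2 the squared harmonic factor is at most C^2 N^eta, half of the available
   N^(2 eta). *)
have [C C0 hC] := succ_le_powR (divr_gt0 eta0 (ltr0n R 2)).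
(* The minimum with eps ensures that nu is at most the exponent rho + eps. *)
pose nu := Num.min eta eps.
have nu0 : 0 < nu by rewrite lt_min eta0.
pose sigma := Num.min eta tau.
have sigma0 : 0 < sigma by rewrite lt_min eta0.
have two1 : 1 < (2 : R) by rewrite ltr1n.
pose q : R := 2 `^ (- sigma).
have q0 : 0 < q by exact: powR_gt0.
have q1 : q < 1.
  rewrite /q powRN invf_lt1 ?powR_gt0//.
  have := @gt0_ltr_powR _ sigma sigma0 1 2; rewrite powR1 => -> //; rewrite nnegrE//.
have [A hA] := choice (fun k => scale (2 ^ k)%N (expn_gt0 2 k)).
have : {ae P, forall w, exists k0, forall k, (k0 <= k)%N -> ~ A k w}.
  apply: (@borel_cantelli_geometric _ _ _ P A (K * (C ^+ 2 + 1)) q) => //.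
  - by move=> k; have [] := hA k.
  - by rewrite mulr_ge0// addr_ge0// sqr_ge0.
  move=> k; have [_ Pk _] := hA k; apply: le_trans Pk _; rewrite lee_fin -mulrA ler_wpM2l//.
  set N : R := (2 ^ k)%:R.
  have N1 : 1 <= N by rewrite ler1n expn_gt0.
  have ND r t : N `^ (r + t) = N `^ r * N `^ t.
    by rewrite powRD// (gt_eqF (lt_le_trans ltr01 N1)) implybT.
  have -> : q ^+ k = N `^ (- sigma).
    by rewrite /q /N natrX -(powR_mulrn k) ?powR_ge0// -powRrM mulrC powRrM (powR_mulrn k).
  rewrite [leRHS]mulrDl mul1r; apply: lerD; last first.
    by apply: ler_powR => //; rewrite lerN2 ge_min lexx orbT.
  apply: (@le_trans _ _ (C ^+ 2 * N `^ (- eta))); last first.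
    by rewrite ler_wpM2l ?sqr_ge0//; apply: ler_powR => //; rewrite lerN2 ge_min lexx.
  rewrite (_ : - eta = eta / 2 * 2 + - (2 * eta)); last by field.
  rewrite [X in _ <= _ * X]ND mulrA ler_wpM2r ?powR_ge0// powRrM (powR_mulrn 2) ?powR_ge0// -exprMn.
  rewrite lerXn2r ?nnegrE ?harmonic_sum_ge0 ?mulr_ge0 ?powR_ge0//.
  exact: le_trans (harmonic_sum_dyadic R k) (hC k).
apply: filterS => w [k0 hk0].
apply: (@cvg_of_dyadic_bound R _ K _ nu k0) => //.
  by rewrite ge_min; apply/orP; right; rewrite lerDr; lra.
move=> k /hk0 nA n nk; have [_ _ /(_ w nA n nk)] := hA k.
move=> /le_trans; apply; rewrite ler_wpM2l//; apply: ler_powR.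
  by rewrite ler1n expn_gt0.
by rewrite lerD2l lerN2 ge_min lexx.
Qed.
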